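(* Assume the consistency of KM and let $\kappa$ be any infinite cardinal. Then there is a model of $\mathrm{KMU}_{\mathrm{R}}$ + AC in which $\kappa$-DC holds and Collection fails.
   Context: Urelement class theory is two-sorted: first-order variables range over sets and urelements (predicate $\mathcal{A}$ for urelements, $\in$), second-order variables over classes. ZU: urelements have no members, Extensionality for sets, Foundation, Pairing, Union, Powerset, Infinity, and Separation (for every class $Y$ and set $x$, $Y\cap x$ is a set). $\mathrm{KMU}_{\mathrm{R}}$ = ZU + Class Extensionality + Replacement (the image of a set under a class function is a set) + Full Comprehension (for every formula $\varphi$, possibly with class parameters and class quantifiers, $\{x:\varphi(x)\}$ is a class); AC: every set is well-orderable. KM is Kelley–Morse class theory without urelements. Collection: if $R$ is a class relation and $w$ a set with $\forall x\in w\,\exists y\,R(x,y)$, then there is a set $v$ with $\forall x\in w\,\exists y\in v\,R(x,y)$. $\kappa$-DC: for every class relation $R$ without terminal nodes (every $x$ has $y$ with $R(x,y)$) there is a function $f$ on $\kappa$ with $R(f\restriction\alpha,f(\alpha))$ for all $\alpha<\kappa$. *)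

(* Defs.v *)
From Stdlib Require Import PeanoNat.

(** * Two-sorted urelement class theory

    Models are Henkin-style: the second sort is an arbitrary type of classes,
    not the full power set of the first sort.  Equality in both sorts is
    interpreted by equality. *)

Record structure : Type := Structure {
  obj : Type;                       (* sets and urelements *)
  cls : Type;                       (* classes *)
  ur : obj -> Prop;                 (* the predicate A *)
  mem : obj -> obj -> Prop;
  cmem : obj -> cls -> Prop;
  obj_inhabited : inhabited obj;
  cls_inhabited : inhabited cls
}.

(** ** Formulas (needed for the comprehension schema)

    First- and second-order variables are two separate copies of [nat]. *)

Inductive formula : Type :=
| FFalse
| FUr (x : nat)
| FEq (x y : nat)
| FMem (x y : nat)
| FCEq (X Y : nat)
| FCMem (x X : nat)
| FImp (p q : formula)
| FAll (x : nat) (p : formula)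
| FCAll (X : nat) (p : formula).

Definition update {T : Type} (e : nat -> T) (n : nat) (a : T) : nat -> T :=
  fun m => if Nat.eqb m n then a else e m.

Fixpoint sat (M : structure) (e : nat -> obj M) (E : nat -> cls M)
    (p : formula) : Prop :=
  match p with
  | FFalse => False
  | FUr x => ur M (e x)
  | FEq x y => e x = e y
  | FMem x y => mem M (e x) (e y)
  | FCEq X Y => E X = E Y
  | FCMem x X => cmem M (e x) (E X)
  | FImp p q => sat M e E p -> sat M e E q
  | FAll x p => forall a : obj M, sat M (update e x a) E p
  | FCAll X p => forall A : cls M, sat M e (update E X A) p
  end.

(** ** Basic set-theoretic vocabulary of a structure

    Pairs, functions and orders are sets of the structure itself. *)

Definition is_set (M : structure) (x : obj M) : Prop := ~ ur M x.

Definition subset (M : structure) (x y : obj M) : Prop :=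
  forall z : obj M, mem M z x -> mem M z y.

Definition is_upair (M : structure) (z x y : obj M) : Prop :=
  forall w : obj M, mem M w z <-> w = x \/ w = y.

(* Kuratowski pairs; having members, [p] is a set as soon as urelements have
   no members. *)
Definition is_pair (M : structure) (p x y : obj M) : Prop :=
  forall z : obj M, mem M z p <-> is_upair M z x x \/ is_upair M z x y.

Definition srel (M : structure) (r x y : obj M) : Prop :=
  exists p : obj M, is_pair M p x y /\ mem M p r.

Definition crel (M : structure) (R : cls M) (x y : obj M) : Prop :=
  exists p : obj M, is_pair M p x y /\ cmem M p R.

Definition is_fun (M : structure) (f d : obj M) : Prop :=
  is_set M f /\
  (forall p, mem M p f -> exists x y, mem M x d /\ is_pair M p x y) /\
  (forall x, mem M x d -> exists! y, srel M f x y).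

Definition is_restriction (M : structure) (g f d : obj M) : Prop :=
  is_set M g /\
  forall p, mem M p g <->
    mem M p f /\ exists x y, mem M x d /\ is_pair M p x y.

Definition is_bijection (M : structure) (f a b : obj M) : Prop :=
  is_fun M f a /\
  (forall x y, srel M f x y -> mem M y b) /\
  (forall x x' y, srel M f x y -> srel M f x' y -> x = x') /\
  (forall y, mem M y b -> exists x, srel M f x y).

Definition well_orders (M : structure) (lt : obj M -> obj M -> Prop)
    (x : obj M) : Prop :=
  (forall a, mem M a x -> ~ lt a a) /\
  (forall a b c, mem M a x -> mem M b x -> mem M c x ->
     lt a b -> lt b c -> lt a c) /\
  (forall a b, mem M a x -> mem M b x -> lt a b \/ a = b \/ lt b a) /\
  (forall y, is_set M y -> subset M y x -> (exists a, mem M a y) ->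
     exists a, mem M a y /\ forall b, mem M b y -> a = b \/ lt a b).

Definition is_ordinal (M : structure) (a : obj M) : Prop :=
  is_set M a /\
  (forall x, mem M x a -> is_set M x /\ subset M x a) /\
  well_orders M (mem M) a.

Definition is_limit (M : structure) (l : obj M) : Prop :=
  is_ordinal M l /\
  (exists x, mem M x l) /\
  (forall x, mem M x l -> exists y, mem M y l /\ mem M x y).

Definition is_cardinal (M : structure) (k : obj M) : Prop :=
  is_ordinal M k /\
  forall a, mem M a k -> ~ exists f, is_bijection M f a k.

(* An ordinal is infinite iff some nonzero limit ordinal is at most it. *)
Definition is_infinite_cardinal (M : structure) (k : obj M) : Prop :=
  is_cardinal M k /\
  exists l, is_limit M l /\ (l = k \/ mem M l k).

(** ** Axioms *)

Definition Urelements_empty (M : structure) : Prop :=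
  forall x y : obj M, ur M x -> ~ mem M y x.

Definition Extensionality (M : structure) : Prop :=
  forall x y : obj M, is_set M x -> is_set M y ->
    (forall z, mem M z x <-> mem M z y) -> x = y.

Definition Foundation (M : structure) : Prop :=
  forall x : obj M, (exists y, mem M y x) ->
    exists y, mem M y x /\ forall z, mem M z y -> ~ mem M z x.

Definition Pairing (M : structure) : Prop :=
  forall x y : obj M, exists z, is_set M z /\ is_upair M z x y.

Definition Union (M : structure) : Prop :=
  forall x : obj M, is_set M x -> exists u, is_set M u /\
    forall z, mem M z u <-> exists y, mem M y x /\ mem M z y.

Definition Powerset (M : structure) : Prop :=
  forall x : obj M, is_set M x -> exists u, is_set M u /\
    forall z, mem M z u <-> is_set M z /\ subset M z x.

Definition Infinity (M : structure) : Prop :=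
  exists i : obj M, is_set M i /\
    (exists z, mem M z i /\ is_set M z /\ forall w, ~ mem M w z) /\
    (forall x, mem M x i ->
       exists s, mem M s i /\ forall w, mem M w s <-> mem M w x \/ w = x).

Definition Separation (M : structure) : Prop :=
  forall (Y : cls M) (x : obj M), is_set M x -> exists z, is_set M z /\
    forall w, mem M w z <-> cmem M w Y /\ mem M w x.

Definition Class_Extensionality (M : structure) : Prop :=
  forall X Y : cls M, (forall x, cmem M x X <-> cmem M x Y) -> X = Y.

Definition Replacement (M : structure) : Prop :=
  forall F : cls M,
    (forall x y y', crel M F x y -> crel M F x y' -> y = y') ->
    forall w : obj M, is_set M w -> exists v, is_set M v /\
      forall y, mem M y v <-> exists x, mem M x w /\ crel M F x y.

(* The assignments [e] and [E] supply the object and class parameters. *)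
Definition Full_Comprehension (M : structure) : Prop :=
  forall (p : formula) (n : nat) (e : nat -> obj M) (E : nat -> cls M),
    exists X : cls M, forall x, cmem M x X <-> sat M (update e n x) E p.

Definition AC (M : structure) : Prop :=
  forall x : obj M, is_set M x ->
    exists r, is_set M r /\ well_orders M (srel M r) x.

Definition Collection (M : structure) : Prop :=
  forall (R : cls M) (w : obj M), is_set M w ->
    (forall x, mem M x w -> exists y, crel M R x y) ->
    exists v, is_set M v /\
      forall x, mem M x w -> exists y, mem M y v /\ crel M R x y.

Definition DC (M : structure) (k : obj M) : Prop :=
  forall R : cls M, (forall x, exists y, crel M R x y) ->
    exists f, is_fun M f k /\
      forall a, mem M a k ->
        exists g y, is_restriction M g f a /\ srel M f a y /\ crel M R g y.

(** ** Theories *)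

Definition ZU (M : structure) : Prop :=
  Urelements_empty M /\ Extensionality M /\ Foundation M /\ Pairing M /\
  Union M /\ Powerset M /\ Infinity M /\ Separation M.

Definition KMU_R (M : structure) : Prop :=
  ZU M /\ Class_Extensionality M /\ Replacement M /\ Full_Comprehension M.

(* No choice principle is included. *)
Definition KM (M : structure) : Prop :=
  KMU_R M /\ forall x : obj M, ~ ur M x.

Definition consistent (T : structure -> Prop) : Prop :=
  exists M : structure, T M.

(* The ordinals [k] of [M] and [k'] of [N] are the same: their members,
   ordered by membership, are isomorphic (externally). *)
Definition same_ordinal (M N : structure) (k : obj M) (k' : obj N) : Prop :=
  exists h : obj M -> obj N,
    (forall a, mem M a k -> mem N (h a) k') /\
    (forall b, mem N b k' -> exists a, mem M a k /\ h a = b) /\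
    (forall a b, mem M a k -> mem M b k ->
       (mem M a b <-> mem N (h a) (h b))).

(* Main.v *)
From Stdlib Require Import PeanoNat Lia Classical ClassicalEpsilon.
From Stdlib Require Import FunctionalExtensionality PropExtensionality.
From mathcomp Require boolp wochoice.
Require Import Defs.

(** Well-founded trees with type-indexed branching, modulo extensional equality and
    with all predicates as classes, are a model of KM + AC.

    Given a model [M] of KM + AC and [kappa], choose a set [K] coding pairs with
    first component in [kappa].  In [M] view a nonempty set as an urelement if it
    does not contain the empty set, and as the set of its nonempty members
    otherwise.  Sort the urelements into columns, the column of [a] being given by
    its trace [a ∩ K]; each column is a proper class.  The objects of the model [N]
    are those whose kernel (the urelements in the transitive closure) meets at most
    [K]-many columns, and its classes are those invariant under all transpositions
    within a column that avoid the kernel of some object.  A value of such a class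
    function has no urelement outside the kernels of the support and the argument,
    because transpositions avoiding these fix it; this gives Replacement.  As the objects are
    closed under [kappa]-sequences, [kappa]-DC is inherited from [M].  Every subset
    [s] of [K] has a urelement with trace [s], but by Cantor's theorem no object
    contains one for each [s], so Collection fails. *)

(** * Definable predicates and comprehension *)

Fixpoint obj_bound (p : formula) : nat :=
  match p with
  | FFalse | FCEq _ _ => 0
  | FUr x | FCMem x _ => S x
  | FEq x y | FMem x y => S (Nat.max x y)
  | FImp p q => Nat.max (obj_bound p) (obj_bound q)
  | FAll x p => S (Nat.max x (obj_bound p))
  | FCAll _ p => obj_bound p
  end.

Fixpoint cls_bound (p : formula) : nat :=
  match p with
  | FFalse | FUr _ | FEq _ _ | FMem _ _ => 0
  | FCEq X Y => S (Nat.max X Y)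
  | FCMem _ X => S X
  | FImp p q => Nat.max (cls_bound p) (cls_bound q)
  | FAll _ p => cls_bound p
  | FCAll X p => S (Nat.max X (cls_bound p))
  end.

Lemma update_same {T} (e : nat -> T) n a : update e n a n = a.
Proof. unfold update; now rewrite Nat.eqb_refl. Qed.

Lemma update_other {T} (e : nat -> T) n m a : m <> n -> update e n a m = e m.
Proof. intro H; unfold update; now apply Nat.eqb_neq in H as ->. Qed.

Lemma update_comp {S T} (f : S -> T) (e : nat -> S) n a :
  (fun m => f (update e n a m)) = update (fun m => f (e m)) n (f a).
Proof. extensionality m; unfold update; now destruct (Nat.eqb m n). Qed.

Lemma update_agree {T} (e e' : nat -> T) n a (Q : nat -> Prop) :
  (forall m, Q m -> e m = e' m) ->
  forall m, Q m -> update e n a m = update e' n a m.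
Proof. intros H m Hm; unfold update; destruct (Nat.eqb m n); auto. Qed.

Lemma all_iff_compat {T} (P Q : T -> Prop) :
  (forall a, P a <-> Q a) -> (forall a, P a) <-> (forall a, Q a).
Proof. firstorder. Qed.

Lemma sat_agree (M : structure) p : forall e e' E E',
  (forall n, n < obj_bound p -> e n = e' n) ->
  (forall n, n < cls_bound p -> E n = E' n) ->
  sat M e E p <-> sat M e' E' p.
Proof.
  induction p; simpl; intros e e' E E' He HE.
  - tauto.
  - now rewrite He by lia.
  - now rewrite !He by lia.
  - now rewrite !He by lia.
  - now rewrite !HE by lia.
  - now rewrite He, HE by lia.
  - rewrite (IHp1 e e' E E'), (IHp2 e e' E E'); [tauto| | | |];
      intros; (apply He || apply HE); lia.
  - apply all_iff_compat; intro a; apply IHp.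
    + apply (update_agree e e' x a (fun n => n < obj_bound p)).
      intros; apply He; lia.
    + intros; apply HE; lia.
  - apply all_iff_compat; intro A; apply IHp.
    + intros; apply He; lia.
    + apply (update_agree E E' X A (fun n => n < cls_bound p)).
      intros; apply HE; lia.
Qed.

Lemma bounded_below (f : nat -> nat) n : exists y, forall i, i < n -> f i < y.
Proof.
  induction n as [|n [y Hy]]; [exists 0; lia|].
  exists (S (Nat.max y (f n))); intros i Hi.
  destruct (Nat.eq_dec i n) as [->|]; [lia|].
  specialize (Hy i ltac:(lia)); lia.
Qed.

Lemma sat_rename (M : structure) p : forall f g, exists p', forall e E,
  sat M e E p' <-> sat M (fun n => e (f n)) (fun n => E (g n)) p.
Proof.
  induction p; intros f g.
  - now exists FFalse.
  - now exists (FUr (f x)).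
  - now exists (FEq (f x) (f y)).
  - now exists (FMem (f x) (f y)).
  - now exists (FCEq (g X) (g Y)).
  - now exists (FCMem (f x) (g X)).
  - destruct (IHp1 f g) as [p1' H1], (IHp2 f g) as [p2' H2].
    exists (FImp p1' p2'); intros; simpl; now rewrite H1, H2.
  - destruct (bounded_below f (obj_bound p)) as [y Hy].
    destruct (IHp (update f x y) g) as [p' Hp'].
    exists (FAll y p'); intros e E; simpl.
    assert (A : forall a, sat M (update e y a) E p' <->
      sat M (update (fun n => e (f n)) x a) (fun n => E (g n)) p).
    { intro a; rewrite Hp'; apply sat_agree; auto; intros n Hn.
      destruct (Nat.eq_dec n x) as [->|Hx].
      - now rewrite !update_same.
      - rewrite !(update_other _ x) by auto; apply update_other.
        specialize (Hy n Hn); lia. }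
    split; intros H a; apply A, H.
  - destruct (bounded_below g (cls_bound p)) as [y Hy].
    destruct (IHp f (update g X y)) as [p' Hp'].
    exists (FCAll y p'); intros e E; simpl.
    assert (A : forall a, sat M e (update E y a) p' <->
      sat M (fun n => e (f n)) (update (fun n => E (g n)) X a) p).
    { intro a; rewrite Hp'; apply sat_agree; auto; intros n Hn.
      destruct (Nat.eq_dec n X) as [->|Hx].
      - now rewrite !update_same.
      - rewrite !(update_other _ X) by auto; apply update_other.
        specialize (Hy n Hn); lia. }
    split; intros H a; apply A, H.
Qed.

Definition interleave {T} (e c : nat -> T) (n : nat) : T :=
  if Nat.even n then e (Nat.div2 n) else c (Nat.div2 n).

Lemma interleave_even {T} (e c : nat -> T) n : interleave e c (2 * n) = e n.
Proof. unfold interleave; now rewrite Nat.even_even, Nat.div2_double. Qed.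

Lemma interleave_odd {T} (e c : nat -> T) n : interleave e c (S (2 * n)) = c n.
Proof.
  unfold interleave. rewrite Nat.div2_succ_double.
  replace (S (2 * n)) with (2 * n + 1) by lia.
  now rewrite Nat.even_odd.
Qed.

Lemma interleave_map {S T} (h : S -> T) (f g : nat -> S) :
  (fun n => h (interleave f g n)) =
  interleave (fun n => h (f n)) (fun n => h (g n)).
Proof. extensionality n; unfold interleave; now destruct (Nat.even n). Qed.

Definition scons {T} (a : T) (e : nat -> T) (n : nat) : T :=
  match n with 0 => a | S n => e n end.

Section Definability.
Context {M : structure}.
Notation V := (obj M).

(* The odd-numbered variables carry the parameters of the definition. *)
Definition definable (P : (nat -> V) -> (nat -> cls M) -> Prop) : Prop :=
  exists p c C, forall e E,
    P e E <-> sat M (interleave e c) (interleave E C) p.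

Definition definable_term (t : (nat -> V) -> (nat -> cls M) -> V) : Prop :=
  definable (fun e E => e 0 = t (fun n => e (S n)) E).

Lemma definable_ext P Q :
  definable P -> (forall e E, P e E <-> Q e E) -> definable Q.
Proof. intros (p & c & C & H) HPQ; exists p, c, C; intros; now rewrite <- HPQ. Qed.

Definition lookup {T} (e : nat -> T) (s : nat + T) : T :=
  match s with inl i => e i | inr v => v end.

Lemma definable_subst P (f : nat -> nat + V) (g : nat -> nat + cls M) :
  definable P ->
  definable (fun e E => P (fun n => lookup e (f n)) (fun n => lookup E (g n))).
Proof.
  intros (p & c & C & H).
  destruct (sat_rename M p
    (interleave (fun n => match f n with inl i => 2 * i | inr _ => S (2 * (S (2 * n))) end)
      (fun n => S (2 * (2 * n))))
    (interleave (fun n => match g n with inl i => 2 * i | inr _ => S (2 * (S (2 * n))) end)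
      (fun n => S (2 * (2 * n))))) as [p' Hp'].
  exists p', (interleave c (fun n => lookup c (f n))),
    (interleave C (fun n => lookup C (g n))).
  intros e E; rewrite Hp', H, !interleave_map.
  assert (A : forall T (e c : nat -> T) (f : nat -> nat + T),
    interleave
      (fun n => interleave e (interleave c (fun n => lookup c (f n)))
         (match f n with inl i => 2 * i | inr _ => S (2 * S (2 * n)) end))
      (fun n => interleave e (interleave c (fun n => lookup c (f n))) (S (2 * (2 * n))))
    = interleave (fun n => lookup e (f n)) c).
  { intros T e0 c0 f0; f_equal; extensionality n.
    - destruct (f0 n) eqn:Hf; simpl lookup.
      + now rewrite interleave_even.
      + rewrite interleave_odd, interleave_odd; now rewrite Hf.
    - now rewrite interleave_odd, interleave_even. }
  now rewrite !A.
Qed.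

Lemma definable_rename P f :
  definable P -> definable (fun e E => P (fun n => e (f n)) E).
Proof. exact (definable_subst P (fun n => inl (f n)) inl). Qed.

Lemma definable_False : definable (fun _ _ => False).
Proof.
  destruct (obj_inhabited M) as [v], (cls_inhabited M) as [C].
  now exists FFalse, (fun _ => v), (fun _ => C).
Qed.

Lemma definable_imp P Q :
  definable P -> definable Q -> definable (fun e E => P e E -> Q e E).
Proof.
  intros (p & c & C & Hp) (q & d & D & Hq).
  destruct (sat_rename M p
    (interleave (fun n => 2 * n) (fun n => S (2 * (2 * n))))
    (interleave (fun n => 2 * n) (fun n => S (2 * (2 * n))))) as [p' Hp'].
  destruct (sat_rename M q
    (interleave (fun n => 2 * n) (fun n => S (2 * S (2 * n))))
    (interleave (fun n => 2 * n) (fun n => S (2 * S (2 * n))))) as [q' Hq'].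
  exists (FImp p' q'), (interleave c d), (interleave C D).
  intros e E; simpl; rewrite Hp', Hq', Hp, Hq, !interleave_map.
  assert (A : forall T (e c d : nat -> T),
    interleave (fun n => interleave e (interleave c d) (2 * n))
      (fun n => interleave e (interleave c d) (S (2 * (2 * n)))) = interleave e c).
  { intros; f_equal; extensionality n;
      now rewrite ?interleave_odd, ?interleave_even. }
  assert (B : forall T (e c d : nat -> T),
    interleave (fun n => interleave e (interleave c d) (2 * n))
      (fun n => interleave e (interleave c d) (S (2 * S (2 * n)))) = interleave e d).
  { intros; f_equal; extensionality n;
      now rewrite ?interleave_odd, ?interleave_even. }
  now rewrite !A, !B.
Qed.

Lemma interleave_scons {T} (e c : nat -> T) a N n : n < N ->
  update (interleave e c) N a
    (match n with 0 => N | _ => if Nat.even n then n - 2 else n end) =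
  interleave (scons a e) c n.
Proof.
  intro Hn. destruct n as [|n]; [apply update_same|].
  destruct (Nat.even (S n)) eqn:He.
  - rewrite update_other by lia.
    apply Nat.even_spec in He as [k Hk]; rewrite Hk.
    replace (2 * k - 2) with (2 * (k - 1)) by lia.
    rewrite !interleave_even; destruct k; [lia|]; simpl; f_equal; lia.
  - rewrite update_other by lia; unfold interleave; now rewrite He.
Qed.

Lemma definable_all P :
  definable P -> definable (fun e E => forall a, P (scons a e) E).
Proof.
  intros (p & c & C & H).
  destruct (sat_rename M p
    (fun n => match n with 0 => obj_bound p | _ => if Nat.even n then n - 2 else n end)
    (fun n => n)) as [q Hq].
  exists (FAll (obj_bound p) q), c, C; intros e E; simpl.
  assert (A : forall a, P (scons a e) E <->
    sat M (update (interleave e c) (obj_bound p) a) (interleave E C) q).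
  { intro a; rewrite Hq, H; apply sat_agree; auto.
    intros n Hn; symmetry; now apply interleave_scons. }
  split; intros; apply A; auto.
Qed.

Lemma definable_call P :
  definable P -> definable (fun e E => forall a, P e (scons a E)).
Proof.
  intros (p & c & C & H).
  destruct (sat_rename M p (fun n => n)
    (fun n => match n with 0 => cls_bound p | _ => if Nat.even n then n - 2 else n end))
    as [q Hq].
  exists (FCAll (cls_bound p) q), c, C; intros e E; simpl.
  assert (A : forall a, P e (scons a E) <->
    sat M (interleave e c) (update (interleave E C) (cls_bound p) a) q).
  { intro a; rewrite Hq, H; apply sat_agree; auto.
    intros n Hn; symmetry; now apply interleave_scons. }
  split; intros; apply A; auto.
Qed.

Lemma definable_forall (Q : V -> (nat -> V) -> (nat -> cls M) -> Prop) :
  definable (fun e E => Q (e 0) (fun n => e (S n)) E) ->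
  definable (fun e E => forall a, Q a e E).
Proof. exact (definable_all (fun e E => Q (e 0) (fun n => e (S n)) E)). Qed.

Lemma definable_cforall (Q : cls M -> (nat -> V) -> (nat -> cls M) -> Prop) :
  definable (fun e E => Q (E 0) e (fun n => E (S n))) ->
  definable (fun e E => forall A, Q A e E).
Proof. exact (definable_call (fun e E => Q (E 0) e (fun n => E (S n)))). Qed.

Lemma definable_not P : definable P -> definable (fun e E => ~ P e E).
Proof. intro H; apply definable_imp; [exact H|apply definable_False]. Qed.

Lemma definable_and P Q :
  definable P -> definable Q -> definable (fun e E => P e E /\ Q e E).
Proof.
  intros HP HQ.
  apply definable_ext with (fun e E => ~ (P e E -> ~ Q e E)).
  - apply definable_not, definable_imp; [|apply definable_not]; assumption.
  - intros; tauto.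
Qed.

Lemma definable_or P Q :
  definable P -> definable Q -> definable (fun e E => P e E \/ Q e E).
Proof.
  intros HP HQ.
  apply definable_ext with (fun e E => ~ P e E -> Q e E).
  - apply definable_imp; [apply definable_not|]; assumption.
  - intros; tauto.
Qed.

Lemma definable_iff P Q :
  definable P -> definable Q -> definable (fun e E => P e E <-> Q e E).
Proof. intros; apply definable_and; apply definable_imp; assumption. Qed.

Lemma definable_exists (Q : V -> (nat -> V) -> (nat -> cls M) -> Prop) :
  definable (fun e E => Q (e 0) (fun n => e (S n)) E) ->
  definable (fun e E => exists a, Q a e E).
Proof.
  intro H; apply definable_ext with (fun e E => ~ forall a, ~ Q a e E).
  - apply definable_not, (definable_forall (fun a e E => ~ Q a e E)).
    now apply definable_not.
  - intros; split; [apply not_all_not_ex|firstorder].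
Qed.

Lemma definable_cexists (Q : cls M -> (nat -> V) -> (nat -> cls M) -> Prop) :
  definable (fun e E => Q (E 0) e (fun n => E (S n))) ->
  definable (fun e E => exists A, Q A e E).
Proof.
  intro H; apply definable_ext with (fun e E => ~ forall A, ~ Q A e E).
  - apply definable_not, (definable_cforall (fun a e E => ~ Q a e E)).
    now apply definable_not.
  - intros; split; [apply not_all_not_ex|firstorder].
Qed.

Lemma definable_atom p : definable (fun e E => sat M e E p).
Proof.
  destruct (sat_rename M p (fun n => 2 * n) (fun n => 2 * n)) as [q Hq].
  destruct (obj_inhabited M) as [v], (cls_inhabited M) as [C].
  exists q, (fun _ => v), (fun _ => C); intros e E; rewrite Hq.
  apply sat_agree; intros; now rewrite interleave_even.
Qed.

Lemma definable_update P x :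
  definable P -> definable (fun e E => forall a, P (update e x a) E).
Proof.
  intro H; apply (definable_forall (fun a e E => P (update e x a) E)).
  apply definable_ext with (fun e E => P (fun n => e (update S x 0 n)) E).
  - now apply definable_rename.
  - intros e E.
    replace (fun n => e (update S x 0 n)) with (update (fun n => e (S n)) x (e 0));
      [tauto|].
    symmetry; apply (update_comp e S).
Qed.

Lemma definable_cupdate P x :
  definable P -> definable (fun e E => forall A, P e (update E x A)).
Proof.
  intro H; apply (definable_cforall (fun A e E => P e (update E x A))).
  apply definable_ext with (fun e E => P e (fun n => E (update S x 0 n))).
  - exact (definable_subst P inl (fun n => inl (update S x 0 n)) H).
  - intros e E.
    replace (fun n => E (update S x 0 n)) with (update (fun n => E (S n)) x (E 0));
      [tauto|].
    symmetry; apply (update_comp E S).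
Qed.

Lemma definable_term_var i : definable_term (fun e _ => e i).
Proof. exact (definable_atom (FEq 0 (S i))). Qed.

Lemma definable_term_const v : definable_term (fun _ _ => v).
Proof.
  exact (definable_subst (fun e _ => e 0 = e 1)
    (fun n => match n with 0 => inl 0 | _ => inr v end) inl
    (definable_atom (FEq 0 1))).
Qed.

Lemma definable_term_shift t :
  definable_term t -> definable_term (fun e E => t (fun n => e (S n)) E).
Proof.
  exact (definable_rename _ (fun n => match n with 0 => 0 | S n => S (S n) end)).
Qed.

Class Definable1 (P : V -> Prop) : Prop :=
  definable1 : definable (fun e _ => P (e 0)).
Class Definable2 (P : V -> V -> Prop) : Prop :=
  definable2 : definable (fun e _ => P (e 0) (e 1)).
Class Definable3 (P : V -> V -> V -> Prop) : Prop :=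
  definable3 : definable (fun e _ => P (e 0) (e 1) (e 2)).
Class Definable4 (P : V -> V -> V -> V -> Prop) : Prop :=
  definable4 : definable (fun e _ => P (e 0) (e 1) (e 2) (e 3)).
Class DefinableFun1 (f : V -> V) : Prop :=
  definable_fun1 : Definable2 (fun y x => y = f x).
Class DefinableFun2 (f : V -> V -> V) : Prop :=
  definable_fun2 : Definable3 (fun z x y => z = f x y).
Class DefinableFun3 (f : V -> V -> V -> V) : Prop :=
  definable_fun3 : Definable4 (fun w x y z => w = f x y z).

Lemma definable_let (Q : V -> (nat -> V) -> (nat -> cls M) -> Prop) t :
  definable_term t ->
  definable (fun e E => Q (e 0) (fun n => e (S n)) E) ->
  definable (fun e E => Q (t e E) e E).
Proof.
  intros Ht HQ.
  apply definable_ext with (fun e E => exists a, a = t e E /\ Q a e E).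
  - apply (definable_exists (fun a e E => a = t e E /\ Q a e E)).
    now apply definable_and.
  - intros; split; [now intros (a & -> & H)|eauto].
Qed.

Lemma definable_app1 P {HP : Definable1 P} t :
  definable_term t -> definable (fun e E => P (t e E)).
Proof. intro Ht; exact (definable_let (fun a _ _ => P a) t Ht HP). Qed.

Lemma definable_app2 P {HP : Definable2 P} s t :
  definable_term s -> definable_term t -> definable (fun e E => P (s e E) (t e E)).
Proof.
  intros Hs Ht.
  apply (definable_let (fun a e E => P (s e E) a) t Ht).
  apply (definable_let (fun a e E => P a (e 0)) _ (definable_term_shift _ Hs)).
  exact HP.
Qed.

Lemma definable_app3 P {HP : Definable3 P} s t u :
  definable_term s -> definable_term t -> definable_term u ->
  definable (fun e E => P (s e E) (t e E) (u e E)).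
Proof.
  intros Hs Ht Hu.
  apply (definable_let (fun a e E => P (s e E) (t e E) a) u Hu).
  apply (definable_let (fun a e E => P (s (fun n => e (S n)) E) a (e 0)) _
    (definable_term_shift _ Ht)).
  apply (definable_let (fun a e E => P a (e 0) (e 1)) _
    (definable_term_shift _ (definable_term_shift _ Hs))).
  exact HP.
Qed.

Lemma definable_app4 P {HP : Definable4 P} s t u v :
  definable_term s -> definable_term t -> definable_term u -> definable_term v ->
  definable (fun e E => P (s e E) (t e E) (u e E) (v e E)).
Proof.
  intros Hs Ht Hu Hv.
  apply (definable_let (fun a e E => P (s e E) (t e E) (u e E) a) v Hv).
  apply (definable_let (fun a e E => P (s (fun n => e (S n)) E)
    (t (fun n => e (S n)) E) a (e 0)) _ (definable_term_shift _ Hu)).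
  apply (definable_let (fun a e E => P (s (fun n => e (S (S n))) E) a (e 0) (e 1)) _
    (definable_term_shift _ (definable_term_shift _ Ht))).
  apply (definable_let (fun a e E => P a (e 0) (e 1) (e 2)) _
    (definable_term_shift _ (definable_term_shift _ (definable_term_shift _ Hs)))).
  exact HP.
Qed.

Lemma definable_term_app1 f {Hf : DefinableFun1 f} t :
  definable_term t -> definable_term (fun e E => f (t e E)).
Proof.
  intro Ht; apply (definable_app2 (fun y x => y = f x) (HP := Hf)).
  - exact (definable_term_var 0).
  - now apply definable_term_shift.
Qed.

Lemma definable_term_app2 f {Hf : DefinableFun2 f} s t :
  definable_term s -> definable_term t -> definable_term (fun e E => f (s e E) (t e E)).
Proof.
  intros Hs Ht; apply (definable_app3 (fun z x y => z = f x y) (HP := Hf)).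
  - exact (definable_term_var 0).
  - now apply definable_term_shift.
  - now apply definable_term_shift.
Qed.

Lemma definable_term_app3 f {Hf : DefinableFun3 f} s t u :
  definable_term s -> definable_term t -> definable_term u ->
  definable_term (fun e E => f (s e E) (t e E) (u e E)).
Proof.
  intros Hs Ht Hu; apply (definable_app4 (fun w x y z => w = f x y z) (HP := Hf)).
  - exact (definable_term_var 0).
  - now apply definable_term_shift.
  - now apply definable_term_shift.
  - now apply definable_term_shift.
Qed.

#[export] Instance mem_definable : Definable2 (mem M).
Proof. exact (definable_atom (FMem 0 1)). Qed.

#[export] Instance eq_definable : Definable2 (@eq V).
Proof. exact (definable_atom (FEq 0 1)). Qed.

Lemma definable_cmem_var t i :
  definable_term t -> definable (fun e E => cmem M (t e E) (E i)).
Proof.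
  intro Ht; apply (definable_let (fun a e E => cmem M a (E i)) t Ht).
  exact (definable_atom (FCMem 0 i)).
Qed.

Lemma definable_cmem_const t A :
  definable_term t -> definable (fun e E => cmem M (t e E) A).
Proof.
  intro Ht; apply (definable_let (fun a e E => cmem M a A) t Ht).
  exact (definable_subst (fun e E => cmem M (e 0) (E 0)) inl
    (fun n => match n with 0 => inr A | _ => inl n end) (definable_atom (FCMem 0 0))).
Qed.

Lemma definable_const (P : Prop) : definable (fun _ _ => P).
Proof.
  destruct (classic P) as [H|H].
  - apply definable_ext with (fun _ _ => False -> False); [|tauto].
    apply definable_imp; apply definable_False.
  - apply definable_ext with (fun _ _ => False); [apply definable_False|tauto].
Qed.

End Definability.

Ltac definability_step :=
  lazymatch goal with
  | |- definable_term (fun e E => e _) => apply definable_term_var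
  | |- definable_term _ =>
      first
        [ simple apply definable_term_const
        | simple eapply definable_term_app1; [solve [typeclasses eauto]|]
        | simple eapply definable_term_app2; [solve [typeclasses eauto]| |]
        | simple eapply definable_term_app3; [solve [typeclasses eauto]| | |] ]
  | |- definable (fun e E => ~ _) => apply definable_not
  | |- definable (fun e E => _ /\ _) => apply definable_and
  | |- definable (fun e E => _ \/ _) => apply definable_or
  | |- definable (fun e E => _ <-> _) => apply definable_iff
  | |- definable (fun e E => forall _ : obj _, _) => apply definable_forall
  | |- definable (fun e E => forall _ : cls _, _) => apply definable_cforall
  | |- definable (fun e E => _ -> _) => apply definable_imp
  | |- definable (fun e E => exists _ : obj _, _) => apply definable_exists
  | |- definable (fun e E => exists _ : cls _, _) => apply definable_cexists
  | |- definable (fun e E => ex (unique _)) => unfold unique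
  | |- definable (fun e E => cmem _ _ (E _)) => apply definable_cmem_var
  | |- definable (fun e E => cmem _ _ _) => apply definable_cmem_const
  | |- definable _ =>
      first
        [ simple eapply definable_app1; [solve [typeclasses eauto]|]
        | simple eapply definable_app2; [solve [typeclasses eauto]| |]
        | simple eapply definable_app3; [solve [typeclasses eauto]| | |]
        | simple eapply definable_app4; [solve [typeclasses eauto]| | | |]
        | simple apply definable_const ]
  end.

Ltac definability :=
  lazymatch goal with
  | |- DefinableFun1 _ => unfold DefinableFun1, Definable2
  | |- DefinableFun2 _ => unfold DefinableFun2, Definable3
  | |- DefinableFun3 _ => unfold DefinableFun3, Definable4
  | |- Definable1 _ => unfold Definable1
  | |- Definable2 _ => unfold Definable2
  | |- Definable3 _ => unfold Definable3
  | |- Definable4 _ => unfold Definable4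
  | |- _ => idtac
  end;
  cbv beta; repeat (definability_step; cbv beta).

#[export] Hint Extern 5 (Definable1 (fun _ => _)) => definability : typeclass_instances.
#[export] Hint Extern 5 (Definable2 (fun _ _ => _)) => definability : typeclass_instances.
#[export] Hint Extern 5 (Definable3 (fun _ _ _ => _)) => definability : typeclass_instances.
#[export] Hint Extern 5 (Definable4 (fun _ _ _ _ => _)) => definability : typeclass_instances.
#[export] Hint Extern 5 (DefinableFun1 (fun _ => _)) => definability : typeclass_instances.
#[export] Hint Extern 5 (DefinableFun2 (fun _ _ => _)) => definability : typeclass_instances.
#[export] Hint Extern 5 (DefinableFun3 (fun _ _ _ => _)) => definability : typeclass_instances.

(** * Set theory inside a model of KM *)

Existing Class KM.

Section InternalSets.
Context {M : structure} {HM : KM M}.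
Notation V := (obj M).
Local Notation "x ∈ y" := (mem M x y) (at level 70).
Local Notation "x ∉ y" := (~ mem M x y) (at level 70).

Lemma no_ur (x : V) : is_set M x.
Proof. apply HM. Qed.

Lemma set_ext (x y : V) : (forall z, z ∈ x <-> z ∈ y) -> x = y.
Proof. apply HM; apply no_ur. Qed.

Lemma class_of (P : V -> Prop) {HP : Definable1 P} :
  exists X, forall x, cmem M x X <-> P x.
Proof.
  destruct HM as ((_ & _ & _ & HC) & _), HP as (p & c & C & Hp).
  destruct (cls_inhabited M) as [A].
  destruct (HC p 0 (interleave c c) (interleave (fun _ => A) C)) as [X HX].
  exists X; intro x; rewrite HX.
  change (P x) with (P (update c 0 x 0)).
  rewrite (Hp (update c 0 x) (fun _ => A)).
  apply sat_agree; [|reflexivity]; intros [|n] _; [reflexivity|].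
  rewrite update_other by lia; unfold interleave.
  destruct (Nat.even (S n)) eqn:Hn; [|reflexivity].
  apply Nat.even_spec in Hn as [k Hk]; rewrite Hk, Nat.div2_double.
  symmetry; apply update_other; lia.
Qed.

Definition the (P : V -> Prop) : V := epsilon (obj_inhabited M) P.

Lemma the_spec (P : V -> Prop) : (exists x, P x) -> P (the P).
Proof. apply epsilon_spec. Qed.

Lemma the_set (Q : V -> Prop) : (exists z, forall w, w ∈ z <-> Q w) ->
  forall w, w ∈ the (fun z => forall w, w ∈ z <-> Q w) <-> Q w.
Proof. exact (the_spec (fun z => forall w, w ∈ z <-> Q w)). Qed.

Definition emp : V := the (fun z => forall w, w ∉ z).
Definition up (x y : V) : V := the (fun z => forall w, w ∈ z <-> w = x \/ w = y).
Definition un (x : V) : V := the (fun z => forall w, w ∈ z <-> exists y, y ∈ x /\ w ∈ y).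
Definition pw (x : V) : V := the (fun z => forall w, w ∈ z <-> subset M w x).
Definition sep (P : V -> Prop) (x : V) : V :=
  the (fun z => forall w, w ∈ z <-> w ∈ x /\ P w).
Definition img (R : V -> V -> Prop) (x : V) : V :=
  the (fun z => forall w, w ∈ z <-> exists v, v ∈ x /\ R v w).

Lemma up_spec x y w : w ∈ up x y <-> w = x \/ w = y.
Proof.
  apply (the_set (fun w => w = x \/ w = y)); clear w.
  destruct HM as (((_ & _ & _ & H & _) & _) & _).
  destruct (H x y) as (z & _ & Hz); eauto.
Qed.

Lemma un_spec x w : w ∈ un x <-> exists y, y ∈ x /\ w ∈ y.
Proof.
  apply (the_set (fun w => exists y, y ∈ x /\ w ∈ y)); clear w.
  destruct HM as (((_ & _ & _ & _ & H & _) & _) & _).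
  destruct (H x (no_ur x)) as (z & _ & Hz); eauto.
Qed.

Lemma pw_spec x w : w ∈ pw x <-> subset M w x.
Proof.
  apply (the_set (fun w => subset M w x)); clear w.
  destruct HM as (((_ & _ & _ & _ & _ & H & _) & _) & _).
  destruct (H x (no_ur x)) as (z & _ & Hz); exists z; intro w; rewrite Hz.
  split; [tauto|split; [apply no_ur|assumption]].
Qed.

Lemma sep_spec P {HP : Definable1 P} x w : w ∈ sep P x <-> w ∈ x /\ P w.
Proof.
  apply (the_set (fun w => w ∈ x /\ P w)); clear w.
  destruct HM as (((_ & _ & _ & _ & _ & _ & _ & H) & _) & _).
  destruct (class_of P) as [Y HY], (H Y x (no_ur x)) as (z & _ & Hz).
  exists z; intro w; rewrite Hz, HY; tauto.
Qed.

Lemma emp_spec w : w ∉ emp.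
Proof.
  revert w; apply (the_spec (fun z => forall w, w ∉ z)).
  destruct (obj_inhabited M) as [x].
  exists (sep (fun _ => False) x); intros w Hw.
  apply sep_spec in Hw; [tauto|typeclasses eauto].
Qed.

Definition sg (x : V) : V := up x x.
Definition cup (x y : V) : V := un (up x y).
Definition op (x y : V) : V := up (sg x) (up x y).

Lemma sg_spec x w : w ∈ sg x <-> w = x.
Proof. unfold sg; rewrite up_spec; tauto. Qed.

Lemma cup_spec x y w : w ∈ cup x y <-> w ∈ x \/ w ∈ y.
Proof.
  unfold cup; rewrite un_spec; split.
  - intros (z & Hz & Hw); apply up_spec in Hz as [-> | ->]; auto.
  - intros [H|H]; eexists; rewrite up_spec; eauto.
Qed.

Lemma sg_inj x y : sg x = sg y -> x = y.
Proof. intro H; apply sg_spec; rewrite <- H; now apply sg_spec. Qed.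

Lemma up_inj x y y' : up x y = up x y' -> y = y'.
Proof.
  intro H.
  assert (A : y ∈ up x y') by (rewrite <- H; apply up_spec; auto).
  assert (B : y' ∈ up x y) by (rewrite H; apply up_spec; auto).
  apply up_spec in A, B; intuition congruence.
Qed.

Lemma op_inj x y x' y' : op x y = op x' y' -> x = x' /\ y = y'.
Proof.
  unfold op; intro H.
  assert (x = x') as <-.
  { assert (A : sg x' ∈ up (sg x) (up x y)) by (rewrite H; apply up_spec; auto).
    apply up_spec in A as [A|A]; [now apply sg_inj in A|].
    apply sg_spec; rewrite A; apply up_spec; auto. }
  split; [reflexivity|]; now apply up_inj, up_inj in H.
Qed.

Lemma is_upair_up z x y : is_upair M z x y <-> z = up x y.
Proof.
  split.
  - intro H; apply set_ext; intro w; now rewrite up_spec.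
  - intros ->; intro w; apply up_spec.
Qed.

Lemma is_pair_op p x y : is_pair M p x y <-> p = op x y.
Proof.
  split.
  - intro H; apply set_ext; intro w.
    unfold op; now rewrite up_spec, (H w), !is_upair_up.
  - intros -> z; rewrite !is_upair_up; apply up_spec.
Qed.

Lemma srel_op r x y : srel M r x y <-> op x y ∈ r.
Proof.
  unfold srel; split.
  - intros (p & Hp & H); apply is_pair_op in Hp; now subst.
  - intro H; exists (op x y); now rewrite is_pair_op.
Qed.

Lemma crel_op R x y : crel M R x y <-> cmem M (op x y) R.
Proof.
  unfold crel; split.
  - intros (p & Hp & H); apply is_pair_op in Hp; now subst.
  - intro H; exists (op x y); now rewrite is_pair_op.
Qed.

Lemma definable_fun1_of_mem f (Q : V -> V -> Prop) :
  (forall x w, w ∈ f x <-> Q w x) -> Definable2 Q -> DefinableFun1 f.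
Proof.
  intros H HQ.
  apply definable_ext with (fun e _ => forall w, w ∈ e 0 <-> Q w (e 1)).
  - definability.
  - intros e _; split; intro A.
    + apply set_ext; intro w; now rewrite A, H.
    + intro w; rewrite A; apply H.
Qed.

Lemma definable_fun2_of_mem f (Q : V -> V -> V -> Prop) :
  (forall x y w, w ∈ f x y <-> Q w x y) -> Definable3 Q -> DefinableFun2 f.
Proof.
  intros H HQ.
  apply definable_ext with (fun e _ => forall w, w ∈ e 0 <-> Q w (e 1) (e 2)).
  - definability.
  - intros e _; split; intro A.
    + apply set_ext; intro w; now rewrite A, H.
    + intro w; rewrite A; apply H.
Qed.

Lemma definable_fun3_of_mem f (Q : V -> V -> V -> V -> Prop) :
  (forall x y u w, w ∈ f x y u <-> Q w x y u) -> Definable4 Q -> DefinableFun3 f.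
Proof.
  intros H HQ.
  apply definable_ext with (fun e _ => forall w, w ∈ e 0 <-> Q w (e 1) (e 2) (e 3)).
  - definability.
  - intros e _; split; intro A.
    + apply set_ext; intro w; now rewrite A, H.
    + intro w; rewrite A; apply H.
Qed.

#[export] Instance up_definable : DefinableFun2 up.
Proof. apply (definable_fun2_of_mem _ _ up_spec); definability. Qed.
#[export] Instance un_definable : DefinableFun1 un.
Proof.
  apply (definable_fun1_of_mem _ (fun w x => exists y, y ∈ x /\ w ∈ y) un_spec).
  definability.
Qed.
#[export] Instance subset_definable : Definable2 (subset M).
Proof. unfold subset; definability. Qed.
#[export] Instance pw_definable : DefinableFun1 pw.
Proof. apply (definable_fun1_of_mem _ (subset M) pw_spec); definability. Qed.
#[export] Instance sg_definable : DefinableFun1 sg.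
Proof. unfold sg; definability. Qed.
#[export] Instance cup_definable : DefinableFun2 cup.
Proof. unfold cup; definability. Qed.
#[export] Instance op_definable : DefinableFun2 op.
Proof. unfold op; definability. Qed.

Lemma img_spec R {HR : Definable2 R} x w :
  (forall v y y', v ∈ x -> R v y -> R v y' -> y = y') ->
  w ∈ img R x <-> exists v, v ∈ x /\ R v w.
Proof.
  intro Hf; apply (the_set (fun w => exists v, v ∈ x /\ R v w)); clear w.
  destruct HM as ((_ & _ & H & _) & _).
  destruct (class_of (fun p => exists v y, v ∈ x /\ p = op v y /\ R v y)) as [F HF].
  assert (A : forall v y, crel M F v y <-> v ∈ x /\ R v y).
  { intros v y; rewrite crel_op, HF; split.
    - intros (v' & y' & Hv & E & HR'); apply op_inj in E as [-> ->]; auto.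
    - intros [Hv HR']; eauto. }
  destruct (H F) with (w := x) as (z & _ & Hz); [|apply no_ur|].
  - intros v y y'; rewrite !A; intros [? ?] [? ?]; eauto.
  - exists z; intro w; rewrite Hz; split.
    + intros (v & Hv & Hw); apply A in Hw as [? ?]; eauto.
    + intros (v & Hv & Hw); exists v; rewrite A; auto.
Qed.

Lemma fimg_spec f {Hf : DefinableFun1 f} x w :
  w ∈ img (fun v y => y = f v) x <-> exists v, v ∈ x /\ w = f v.
Proof. apply img_spec; [typeclasses eauto|congruence]. Qed.

Lemma foundation x : (exists y, y ∈ x) ->
  exists y, y ∈ x /\ forall z, z ∈ y -> z ∉ x.
Proof. destruct HM as (((_ & _ & H & _) & _) & _); apply H. Qed.

Lemma no_2cycle x y : x ∈ y -> y ∉ x.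
Proof.
  intros Hxy Hyx.
  destruct (foundation (up x y)) as (z & Hz & H); [exists x; apply up_spec; auto|].
  apply up_spec in Hz as [-> | ->].
  - apply (H y); [assumption|apply up_spec; auto].
  - apply (H x); [assumption|apply up_spec; auto].
Qed.

Definition suc (x : V) : V := cup x (sg x).

Lemma suc_spec x w : w ∈ suc x <-> w ∈ x \/ w = x.
Proof. unfold suc; now rewrite cup_spec, sg_spec. Qed.

#[export] Instance suc_definable : DefinableFun1 suc.
Proof. unfold suc; definability. Qed.

Lemma suc_inj x y : suc x = suc y -> x = y.
Proof.
  intro H.
  assert (A : x ∈ suc y) by (rewrite <- H; apply suc_spec; auto).
  assert (B : y ∈ suc x) by (rewrite H; apply suc_spec; auto).
  apply suc_spec in A as [A|A], B as [B|B]; auto.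
  contradiction (no_2cycle x y A B).
Qed.

Lemma suc_not_emp x : suc x <> emp.
Proof. intro H; apply (emp_spec x); rewrite <- H; apply suc_spec; auto. Qed.

Lemma emp_ext x : (forall w, w ∉ x) -> x = emp.
Proof.
  intro H; apply set_ext; intro w; split; intro A; [destruct (H w A)|].
  destruct (emp_spec w A).
Qed.

Lemma inductive_set_exists :
  exists i, emp ∈ i /\ forall x, x ∈ i -> suc x ∈ i.
Proof.
  destruct HM as (((_ & _ & _ & _ & _ & _ & H & _) & _) & _).
  destruct H as (i & _ & (z & Hz & _ & Ez) & Hs).
  exists i; split.
  - now rewrite <- (emp_ext z Ez).
  - intros x Hx; destruct (Hs x Hx) as (s & Hs1 & Hs2).
    replace (suc x) with s; [assumption|].
    apply set_ext; intro w; now rewrite Hs2, suc_spec.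
Qed.

(* [iter_rel F x n y] says that [y] is reached from [x] in [n] steps [z ∈ F y],
   for [n] an internal natural number. *)
Definition iter_closed (F : V -> V) (x : V) (X : cls M) : Prop :=
  cmem M (op emp x) X /\
  forall n y z, cmem M (op n y) X -> z ∈ F y -> cmem M (op (suc n) z) X.

Definition iter_rel (F : V -> V) (x n y : V) : Prop :=
  forall X, iter_closed F x X -> cmem M (op n y) X.

#[export] Instance iter_rel_definable F {HF : DefinableFun1 F} : Definable3 (iter_rel F).
Proof. unfold iter_rel, iter_closed; definability. Qed.

Lemma iter_rel_inv F {HF : DefinableFun1 F} x n z : iter_rel F x n z ->
  (n = emp /\ z = x) \/ exists m y, n = suc m /\ iter_rel F x m y /\ z ∈ F y.
Proof.
  intro H.
  destruct (class_of (fun p => exists n z, p = op n z /\ iter_rel F x n z /\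
    ((n = emp /\ z = x) \/
     exists m y, n = suc m /\ iter_rel F x m y /\ z ∈ F y))) as [X HX].
  assert (A : cmem M (op n z) X).
  { apply H; split.
    - apply HX; exists emp, x; split; [reflexivity|split; [|auto]].
      intros Y HY; apply HY.
    - intros m y w Hm Hw; apply HX; exists (suc m), w; split; [reflexivity|].
      apply HX in Hm as (m' & y' & E & Hr & _); apply op_inj in E as [<- <-].
      split; [|eauto 6].
      intros Y HY; eapply HY; [|exact Hw]; now apply Hr. }
  apply HX in A as (n' & z' & E & _ & A).
  now apply op_inj in E as [<- <-].
Qed.

Lemma closure_exists F {HF : DefinableFun1 F} x :
  exists K, x ∈ K /\ forall y z, y ∈ K -> z ∈ F y -> z ∈ K.
Proof.
  destruct inductive_set_exists as (i & Hi0 & HiS).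
  destruct (class_of (fun n => n ∈ i /\ exists s, forall z, z ∈ s <-> iter_rel F x n z))
    as [G HG].
  assert (G0 : cmem M emp G).
  { apply HG; split; [assumption|]; exists (sg x); intro z; rewrite sg_spec; split.
    - intros -> X HX; apply HX.
    - intro H; apply iter_rel_inv in H as [[_ H]|(m & y & E & _)]; auto.
      now apply eq_sym, suc_not_emp in E. }
  assert (GS : forall n, cmem M n G -> cmem M (suc n) G).
  { intros n Hn; apply HG in Hn as [Hn [s Hs]]; apply HG.
    split; [now apply HiS|].
    exists (un (img (fun v y => y = F v) s)); intro z.
    rewrite un_spec; split.
    - intros (w & Hw & Hz); apply fimg_spec in Hw as (y & Hy & ->); auto.
      intros X HX; eapply HX; [|exact Hz]; apply Hs in Hy; now apply Hy.
    - intro H; apply iter_rel_inv in H as [[E _]|(m & y & E & Hy & Hz)]; auto.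
      + now apply suc_not_emp in E.
      + apply suc_inj in E as <-; exists (F y); split; [|assumption].
        apply fimg_spec; auto; exists y; split; [now apply Hs|reflexivity]. }
  assert (GI : forall n y, iter_rel F x n y -> cmem M n G).
  { intros n y H.
    destruct (class_of (fun p => exists n y, p = op n y /\ cmem M n G)) as [X HX].
    assert (A : cmem M (op n y) X).
    { apply H; split.
      - apply HX; eauto.
      - intros m w z Hm Hz; apply HX.
        apply HX in Hm as (m' & w' & E & Hm); apply op_inj in E as [<- <-]; eauto. }
    apply HX in A as (n' & y' & E & A); now apply op_inj in E as [<- <-]. }
  pose (R n s := forall z, z ∈ s <-> iter_rel F x n z).
  assert (HR : Definable2 R).
  { unfold R; definability. }
  assert (Hi : forall w, w ∈ img R i <-> exists v, v ∈ i /\ R v w).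
  { intro w; apply img_spec; [assumption|].
    intros v y y' _ H1 H2; apply set_ext; intro z.
    specialize (H1 z); specialize (H2 z); tauto. }
  assert (HK : forall y, y ∈ un (img R i) <-> exists n, iter_rel F x n y).
  { intro y; rewrite un_spec; split.
    - intros (s & Hs & Hy); apply Hi in Hs as (n & _ & Hs); exists n; now apply Hs.
    - intros [n Hn]; pose proof (GI n y Hn) as Hg; apply HG in Hg as [Hg [s Hs]].
      exists s; rewrite Hi; split; [|now apply Hs]; exists n; now split. }
  exists (un (img R i)); split.
  - apply HK; exists emp; intros X HX; apply HX.
  - intros y z Hy Hz; apply HK in Hy as [n Hn]; apply HK; exists (suc n).
    intros X HX; eapply HX; [|exact Hz]; now apply Hn.
Qed.

Lemma mem_induction (P : V -> Prop) {HP : Definable1 P} :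
  (forall x, (forall y, y ∈ x -> P y) -> P x) -> forall x, P x.
Proof.
  intros H x; apply NNPP; intro Hx.
  destruct (closure_exists (fun y => y)) with (x := x) as (K & HxK & HK).
  assert (HB : forall z, z ∈ sep (fun z => ~ P z) K <-> z ∈ K /\ ~ P z).
  { intro z; apply sep_spec; definability. }
  destruct (foundation (sep (fun z => ~ P z) K)) as (y & Hy & Hmin).
  - exists x; now apply HB.
  - apply HB in Hy as [HyK Hy]; apply Hy, H; intros z Hz; apply NNPP; intro Hz'.
    apply (Hmin z Hz), HB; eauto.
Qed.

(** ** Comparison of ranks *)

(* [rle x y] compares ranks without ordinals: it is the largest relation for which
   every member of [x] is below some member of [y], and [{x | rle x y}] is a level
   of the cumulative hierarchy. *)
Definition rank_sim (X : cls M) : Prop :=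
  forall x y, cmem M (op x y) X ->
    forall x', x' ∈ x -> exists y', y' ∈ y /\ cmem M (op x' y') X.

Definition rle (x y : V) : Prop := exists X, rank_sim X /\ cmem M (op x y) X.

#[export] Instance rle_definable : Definable2 rle.
Proof. unfold rle, rank_sim; definability. Qed.

Lemma rle_unfold x y :
  rle x y <-> forall x', x' ∈ x -> exists y', y' ∈ y /\ rle x' y'.
Proof.
  split.
  - intros (X & HX & H) x' Hx'; destruct (HX x y H x' Hx') as (y' & Hy' & H').
    exists y'; split; [assumption|]; now exists X.
  - intro H.
    destruct (class_of (fun p => exists u v, p = op u v /\ (rle u v \/ u = x /\ v = y)))
      as [X HX].
    exists X; split; [|apply HX; eauto 6].
    intros u v Huv u' Hu'; apply HX in Huv as (u1 & v1 & E & Huv).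
    apply op_inj in E as [<- <-].
    assert (A : exists v', v' ∈ v /\ rle u' v').
    { destruct Huv as [(Y & HY & Huv)|[-> ->]]; [|auto].
      destruct (HY u v Huv u' Hu') as (v' & Hv' & A).
      exists v'; split; [assumption|now exists Y]. }
    destruct A as (v' & Hv' & A); exists v'; split; [assumption|]; apply HX; eauto 6.
Qed.

Lemma rle_refl x : rle x x.
Proof.
  revert x; apply (mem_induction (fun x => rle x x)).
  intros x IH; apply rle_unfold; eauto.
Qed.

Lemma rle_trans x y z : rle x y -> rle y z -> rle x z.
Proof.
  revert x y z.
  apply (mem_induction (fun x => forall y z, rle x y -> rle y z -> rle x z)).
  intros x IH y z Hxy Hyz; apply rle_unfold; intros x' Hx'.
  rewrite rle_unfold in Hxy, Hyz.
  destruct (Hxy x' Hx') as (y' & Hy' & H1), (Hyz y' Hy') as (z' & Hz' & H2); eauto.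
Qed.

Lemma rle_total x y : ~ rle x y -> exists x', x' ∈ x /\ rle y x'.
Proof.
  revert x y.
  apply (mem_induction (fun x => forall y, ~ rle x y -> exists x', x' ∈ x /\ rle y x')).
  intros x IH y H; apply NNPP; intro A; apply H, rle_unfold; intros x' Hx'.
  apply NNPP; intro B; apply A; exists x'; split; [assumption|].
  apply rle_unfold; intros y' Hy'; apply IH; eauto.
Qed.

Lemma mem_not_rle x y : x ∈ y -> ~ rle y x.
Proof.
  revert x y; apply (mem_induction (fun x => forall y, x ∈ y -> ~ rle y x)).
  intros x IH y Hxy Hyx; rewrite rle_unfold in Hyx.
  destruct (Hyx x Hxy) as (x' & Hx' & H); eapply IH; eauto.
Qed.

Lemma mem_rle x y : x ∈ y -> rle x y.
Proof.
  revert x y; apply (mem_induction (fun x => forall y, x ∈ y -> rle x y)).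
  intros x IH y Hxy; apply rle_unfold; intros x' Hx'; exists x; auto.
Qed.

Lemma rle_bounded_set y : exists s, forall x, x ∈ s <-> rle x y.
Proof.
  revert y; apply (mem_induction (fun y => exists s, forall x, x ∈ s <-> rle x y)).
  intros y IH.
  pose (R v s := forall x, x ∈ s <-> rle x v).
  assert (HR : Definable2 R) by (unfold R; definability).
  assert (HI : forall w, w ∈ img R y <-> exists v, v ∈ y /\ R v w).
  { intro w; apply img_spec; [assumption|].
    intros v s s' _ H1 H2; apply set_ext; intro x.
    specialize (H1 x); specialize (H2 x); tauto. }
  exists (pw (un (img R y))); intro x; rewrite pw_spec, rle_unfold.
  unfold subset; apply all_iff_compat; intro x'.
  rewrite un_spec; split; intros H Hx'.
  - destruct (H Hx') as (s & Hs & Hs'); apply HI in Hs as (v & Hv & Hs).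
    exists v; split; [assumption|now apply Hs].
  - destruct (H Hx') as (v & Hv & Hs'), (IH v Hv) as [s Hs].
    exists s; rewrite HI; split; [|now apply Hs]; exists v; now split.
Qed.

Lemma rle_minimal (P : V -> Prop) {HP : Definable1 P} :
  (exists x, P x) -> exists x, P x /\ forall y, P y -> rle x y.
Proof.
  intros [x0 Hx0]; apply NNPP; intro H.
  assert (A : forall x y, P y -> ~ rle y x).
  { apply (mem_induction (fun x => forall y, P y -> ~ rle y x)).
    intros x IH y Hy Hyx; apply H; exists y; split; [assumption|].
    intros z Hz; apply NNPP; intro B; apply rle_total in B as (y' & Hy' & Hzy').
    rewrite rle_unfold in Hyx; destruct (Hyx y' Hy') as (x' & Hx' & C).
    apply (IH x' Hx' z Hz); now apply rle_trans with y'. }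
  exact (A x0 x0 Hx0 (rle_refl x0)).
Qed.

(* Scott's trick *)
Definition scott (P : V -> Prop) : V :=
  the (fun s => forall x, x ∈ s <-> P x /\ forall y, P y -> rle x y).

Lemma scott_spec P {HP : Definable1 P} x :
  x ∈ scott P <-> P x /\ forall y, P y -> rle x y.
Proof.
  apply (the_set (fun x => P x /\ forall y, P y -> rle x y)); clear x.
  destruct (classic (exists x, P x)) as [[y Hy]|H].
  - destruct (rle_bounded_set y) as [s Hs].
    exists (sep (fun x => P x /\ forall y, P y -> rle x y) s); intro x.
    rewrite (sep_spec _); rewrite Hs.
    split; [tauto|]; intros [H1 H2]; auto.
  - exists emp; intro x; split; intro A; [now apply emp_spec in A|].
    destruct H; exists x; tauto.
Qed.

(** ** Recursion *)

Definition fun_on (g x : V) : Prop :=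
  (forall p, p ∈ g -> exists v y, v ∈ x /\ p = op v y) /\
  (forall v, v ∈ x -> exists! y, op v y ∈ g).

#[export] Instance fun_on_definable : Definable2 fun_on.
Proof. unfold fun_on; definability. Qed.

Lemma fun_on_functional g x v y y' : fun_on g x -> op v y ∈ g -> op v y' ∈ g -> y = y'.
Proof.
  intros [H1 H2] A B; destruct (H1 _ A) as (v' & z & Hv & E).
  apply op_inj in E as [<- <-]; destruct (H2 v Hv) as (z & Hz & Hu).
  now rewrite <- (Hu y A), <- (Hu y' B).
Qed.

Lemma fun_on_dom g x v y : fun_on g x -> op v y ∈ g -> v ∈ x.
Proof.
  intros [H1 _] A; destruct (H1 _ A) as (v' & z & Hv & E).
  now apply op_inj in E as [<- <-].
Qed.

Section Recursion.
Context (H : V -> V -> V -> V) {HH : DefinableFun3 H}.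

Definition rec_closed (p : V) (X : cls M) : Prop :=
  forall x g, fun_on g x -> (forall q, q ∈ g -> cmem M q X) ->
    cmem M (op x (H p x g)) X.

Definition rec_graph (p x y : V) : Prop :=
  forall X, rec_closed p X -> cmem M (op x y) X.

Instance rec_graph_definable : Definable3 rec_graph.
Proof. unfold rec_graph, rec_closed; definability. Qed.

Definition rec (p x : V) : V := the (rec_graph p x).

Lemma rec_graph_intro p x g : fun_on g x ->
  (forall v y, op v y ∈ g -> rec_graph p v y) -> rec_graph p x (H p x g).
Proof.
  intros Hg Hr X HX; apply HX; [assumption|].
  intros q Hq; destruct (proj1 Hg q Hq) as (v & y & Hv & ->); now apply Hr.
Qed.

Lemma rec_graph_inv p x y : rec_graph p x y ->
  exists g, fun_on g x /\ (forall v z, op v z ∈ g -> rec_graph p v z) /\ y = H p x g.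
Proof.
  intro Hr.
  pose (Q x y := exists g, fun_on g x /\
    (forall v z, op v z ∈ g -> rec_graph p v z) /\ y = H p x g).
  assert (HQ : Definable2 Q) by (unfold Q; definability).
  destruct (class_of (fun q => exists x y, q = op x y /\ Q x y)) as [X HX].
  assert (A : cmem M (op x y) X).
  { apply Hr; intros u g Hg Hq; apply HX; exists u, (H p u g); split; [reflexivity|].
    exists g; split; [assumption|]; split; [|reflexivity].
    intros v z Hvz; apply Hq, HX in Hvz as (v' & z' & E & g' & Hg' & Hr' & ->).
    apply op_inj in E as [<- ->]; now apply rec_graph_intro. }
  apply HX in A as (x' & y' & E & A); now apply op_inj in E as [<- <-].
Qed.

Lemma rec_graph_unique p x : exists! y, rec_graph p x y.
Proof.
  revert x.
  apply (mem_induction (fun x => exists! y, rec_graph p x y)).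
  intros x IH.
  pose (R v q := exists y, q = op v y /\ rec_graph p v y).
  assert (HR : Definable2 R) by (unfold R; definability).
  assert (HI : forall w, w ∈ img R x <-> exists v, v ∈ x /\ R v w).
  { intro w; apply img_spec; [assumption|].
    intros v q q' Hv (y & -> & Hy) (y' & -> & Hy').
    destruct (IH v Hv) as (z & _ & Hz); now rewrite <- (Hz y Hy), <- (Hz y' Hy'). }
  assert (HI' : forall v y, op v y ∈ img R x <-> v ∈ x /\ rec_graph p v y).
  { intros v y; rewrite HI; split.
    - intros (v' & Hv & y' & E & Hy); now apply op_inj in E as [-> ->].
    - intros [Hv Hy]; exists v; split; [assumption|]; now exists y. }
  assert (Hf : fun_on (img R x) x).
  { split.
    - intros q Hq; apply HI in Hq as (v & Hv & y & -> & _); eauto.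
    - intros v Hv; destruct (IH v Hv) as (y & Hy & Hu); exists y; split.
      + now apply HI'.
      + intros y' Hy'; apply HI' in Hy'; now apply Hu. }
  exists (H p x (img R x)); split.
  - apply rec_graph_intro; [assumption|]; intros v y Hvy; now apply HI' in Hvy.
  - intros y' Hy'; apply rec_graph_inv in Hy' as (g & Hg & Hr & ->).
    f_equal; apply set_ext; intro q; split; intro Hq.
    + apply HI in Hq as (v & Hv & y & -> & Hy).
      destruct (proj2 Hg v Hv) as (y' & Hy' & _).
      destruct (IH v Hv) as (z & _ & Hz).
      now rewrite <- (Hz y Hy), (Hz y' (Hr _ _ Hy')).
    + destruct (proj1 Hg q Hq) as (v & y & Hv & ->); apply HI'; auto.
Qed.

Lemma rec_graph_rec p x y : rec_graph p x y <-> y = rec p x.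
Proof.
  destruct (rec_graph_unique p x) as (z & Hz & Hu).
  assert (A : rec_graph p x (rec p x)) by (apply (the_spec (rec_graph p x)); eauto).
  split; [intro B|now intros ->].
  now rewrite <- (Hu _ A), <- (Hu _ B).
Qed.

Lemma rec_definable : DefinableFun2 rec.
Proof.
  apply definable_ext with (fun e _ => rec_graph (e 1) (e 2) (e 0)).
  - definability.
  - intros; apply rec_graph_rec.
Qed.

Lemma rec_unfold p x : exists g, fun_on g x /\
  (forall v y, op v y ∈ g <-> v ∈ x /\ y = rec p v) /\ rec p x = H p x g.
Proof.
  assert (A : rec_graph p x (rec p x)) by now apply rec_graph_rec.
  apply rec_graph_inv in A as (g & Hg & Hr & E).
  exists g; split; [assumption|]; split; [|assumption].
  intros v y; split.
  - intro Hv; split; [now apply fun_on_dom with g y|]; now apply rec_graph_rec, Hr.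
  - intros [Hv ->]; destruct (proj2 Hg v Hv) as (y & Hy & _).
    replace (rec p v) with y; [assumption|]; now apply rec_graph_rec, Hr.
Qed.
End Recursion.

Definition ran (g : V) : V := sep (fun y => exists v, op v y ∈ g) (un (un g)).

Lemma ran_spec g y : y ∈ ran g <-> exists v, op v y ∈ g.
Proof.
  unfold ran; rewrite (sep_spec _); split; [tauto|].
  intros [v Hv]; split; [|eauto]; apply un_spec; exists (up v y).
  rewrite up_spec; split; [|auto]; apply un_spec; exists (op v y).
  split; [assumption|]; unfold op; apply up_spec; auto.
Qed.

#[export] Instance ran_definable : DefinableFun1 ran.
Proof.
  apply (definable_fun1_of_mem _ (fun y g => exists v, op v y ∈ g) ran_spec).
  definability.
Qed.

End InternalSets.

(** * Urelements, transpositions and small kernels *)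

Section Urelements.
Context {M : structure} {HM : KM M}.
Notation V := (obj M).
Local Notation "x ∈ y" := (mem M x y) (at level 70).
Local Notation "x ∉ y" := (~ mem M x y) (at level 70).

Definition nm (v y : V) : Prop := v <> emp /\ emp ∈ y /\ v ∈ y.
Definition atom (a : V) : Prop := a <> emp /\ emp ∉ a.

#[export] Instance nm_definable : Definable2 nm.
Proof. unfold nm; definability. Qed.
#[export] Instance atom_definable : Definable1 atom.
Proof. unfold atom; definability. Qed.

Lemma nset_ext x y : emp ∈ x -> emp ∈ y -> (forall v, nm v x <-> nm v y) -> x = y.
Proof.
  intros Hx Hy H; apply set_ext; intro w.
  destruct (classic (w = emp)) as [->|Hw]; [tauto|].
  specialize (H w); unfold nm in H; tauto.
Qed.

Lemma emp_neq_of_mem x : emp ∈ x -> x <> emp.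
Proof. intros H ->; exact (emp_spec _ H). Qed.

Lemma atom_or_set x : x <> emp -> atom x \/ emp ∈ x.
Proof. intro H; destruct (classic (emp ∈ x)); [auto|left; now split]. Qed.

Definition rt (a u : V) : Prop := forall X : cls M, cmem M a X ->
  (forall v y, nm v y -> cmem M v X -> cmem M y X) -> cmem M u X.

#[export] Instance rt_definable : Definable2 rt.
Proof. unfold rt; definability. Qed.

Lemma rt_refl a : rt a a.
Proof. intros X H _; exact H. Qed.

Lemma rt_step a v y : nm v y -> rt a v -> rt a y.
Proof. intros Hn Hv X Ha HX; apply (HX v y Hn), Hv; assumption. Qed.

Lemma rt_ind a (P : V -> Prop) {HP : Definable1 P} :
  P a -> (forall v y, nm v y -> rt a v -> P v -> P y) -> forall u, rt a u -> P u.
Proof.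
  intros H0 HS u Hu.
  destruct (class_of (fun u => rt a u /\ P u)) as [X HX].
  enough (A : cmem M u X) by now apply HX in A.
  apply Hu.
  - apply HX; split; [apply rt_refl|assumption].
  - intros v y Hn Hv; apply HX in Hv as [Hr Hv]; apply HX; split; [|eauto].
    now apply rt_step with v.
Qed.

Lemma rt_inv a u : rt a u -> u = a \/ exists v, nm v u /\ rt a v.
Proof.
  revert u; apply (rt_ind a (fun u => u = a \/ exists v, nm v u /\ rt a v)); eauto.
Qed.

Lemma rt_set a y : atom a -> emp ∈ y -> rt a y -> exists v, nm v y /\ rt a v.
Proof.
  intros Ha Hy H; apply rt_inv in H as [->|H]; [|assumption].
  now destruct Ha.
Qed.

Lemma rt_rle a u : rt a u -> rle a u.
Proof.
  revert u; apply (rt_ind a (fun u => rle a u)); [apply rle_refl|].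
  intros v y (_ & _ & H) _ IH; apply rle_trans with v; [assumption|].
  now apply mem_rle.
Qed.

(** ** Transposition of two urelements *)

(* A transposition enters the recursion as the unordered pair of its points. *)
Definition sw (p x : V) : V :=
  the (fun z => p = up x z \/ (forall w, p <> up x w) /\ z = x).

Lemma sw_spec p x z : z = sw p x <-> p = up x z \/ (forall w, p <> up x w) /\ z = x.
Proof.
  assert (A : p = up x (sw p x) \/ (forall w, p <> up x w) /\ sw p x = x).
  { apply (the_spec (fun z => p = up x z \/ (forall w, p <> up x w) /\ z = x)).
    destruct (classic (exists w, p = up x w)) as [[w Hw]|H]; [eauto|].
    exists x; right; split; [|reflexivity]; intros w Hw; eauto. }
  split; [now intros ->|].
  intros [H|[H ->]]; destruct A as [A|[A E]].
  - apply (up_inj x); now rewrite <- H.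
  - now destruct (A z).
  - now destruct (H (sw p x)).
  - congruence.
Qed.

Instance sw_definable : DefinableFun2 sw.
Proof.
  apply definable_ext with (fun e _ => e 1 = up (e 2) (e 0) \/
    (forall w, e 1 <> up (e 2) w) /\ e 0 = e 2).
  - definability.
  - intros; symmetry; apply sw_spec.
Qed.

Definition pi_step (p x g : V) : V :=
  if excluded_middle_informative (emp ∈ x) then cup (ran g) (sg emp) else sw p x.

Instance pi_step_definable : DefinableFun3 pi_step.
Proof.
  apply definable_ext with (fun e _ =>
    (emp ∈ e 2 -> e 0 = cup (ran (e 3)) (sg emp)) /\
    (emp ∉ e 2 -> e 0 = sw (e 1) (e 2))).
  - definability.
  - intros e _; unfold pi_step.
    destruct (excluded_middle_informative (emp ∈ e 2)); tauto.
Qed.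

Definition pi (a b u : V) : V := rec pi_step (up a b) u.

#[export] Instance pi_definable : DefinableFun3 pi.
Proof.
  pose proof (rec_definable pi_step) as H; unfold pi; definability.
Qed.

Lemma pi_mem a b y : emp ∈ y ->
  forall w, w ∈ pi a b y <-> w = emp \/ exists v, v ∈ y /\ w = pi a b v.
Proof.
  intros Hy w; unfold pi.
  destruct (rec_unfold pi_step (up a b) y) as (g & _ & Hg & ->).
  unfold pi_step at 1; destruct (excluded_middle_informative (emp ∈ y)); [|tauto].
  rewrite cup_spec, ran_spec, sg_spec.
  split; intros [H|H]; auto.
  - destruct H as [v Hv]; apply Hg in Hv; eauto.
  - destruct H as [v Hv]; left; exists v; now apply Hg.
Qed.

Lemma pi_leaf a b x : emp ∉ x -> pi a b x = sw (up a b) x.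
Proof.
  intros Hx; unfold pi.
  destruct (rec_unfold pi_step (up a b) x) as (g & _ & Hg & ->).
  unfold pi_step; now destruct (excluded_middle_informative (emp ∈ x)).
Qed.

Lemma pi_left a b : emp ∉ a -> pi a b a = b.
Proof.
  intro H; rewrite pi_leaf by assumption; symmetry; apply sw_spec; auto.
Qed.

Lemma up_comm (a b : V) : up a b = up b a.
Proof. apply set_ext; intro w; rewrite !up_spec; tauto. Qed.

Lemma pi_comm a b u : pi a b u = pi b a u.
Proof. unfold pi; now rewrite up_comm. Qed.

Lemma pi_right a b : emp ∉ b -> pi a b b = a.
Proof. rewrite pi_comm; apply pi_left. Qed.

Lemma pi_other a b x : emp ∉ x -> x <> a -> x <> b -> pi a b x = x.
Proof.
  intros Hx Ha Hb; rewrite pi_leaf by assumption; symmetry; apply sw_spec; right.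
  split; [|reflexivity]; intros w E.
  assert (A : x ∈ up a b) by (rewrite E; apply up_spec; auto).
  apply up_spec in A; tauto.
Qed.

Lemma pi_set a b y : emp ∈ y -> emp ∈ pi a b y.
Proof. intro H; apply pi_mem; auto. Qed.

Section Swap.
Context {a b : V} (Ha : atom a) (Hb : atom b).

Lemma pi_emp : pi a b emp = emp.
Proof.
  apply pi_other; [apply emp_spec| |]; intro E;
    [exact (proj1 Ha (eq_sym E))|exact (proj1 Hb (eq_sym E))].
Qed.

Lemma pi_atom c : atom c -> atom (pi a b c).
Proof.
  intro Hc.
  destruct (classic (c = a)) as [->|H1]; [now rewrite pi_left by apply Ha|].
  destruct (classic (c = b)) as [->|H2]; [now rewrite pi_right by apply Hb|].
  now rewrite pi_other by (assumption || apply Hc).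
Qed.

Lemma pi_neq_emp x : x <> emp -> pi a b x <> emp.
Proof.
  intro H; destruct (atom_or_set x H) as [A|A].
  - now apply pi_atom.
  - now apply emp_neq_of_mem, pi_set.
Qed.

Lemma pi_nm y z : emp ∈ y -> nm z (pi a b y) <-> exists v, nm v y /\ z = pi a b v.
Proof.
  intro Hy; unfold nm; rewrite (pi_mem a b y Hy z); split.
  - intros (H & _ & [H'|(v & Hv & ->)]); [contradiction|]; exists v.
    repeat split; auto; intros ->; now apply H, pi_emp.
  - intros (v & (H1 & _ & H2) & ->); repeat split; eauto.
    + now apply pi_neq_emp.
    + now apply pi_set.
Qed.

Lemma pi_involutive x : pi a b (pi a b x) = x.
Proof.
  revert x; apply (mem_induction (fun x => pi a b (pi a b x) = x)); intros x IH.
  destruct (classic (emp ∈ x)) as [Hx|Hx].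
  - apply nset_ext; [now do 2 apply pi_set|assumption|]; intro v.
    rewrite pi_nm by now apply pi_set.
    split.
    + intros (w & Hw & ->); apply pi_nm in Hw as (v' & Hv' & ->); [|assumption].
      rewrite IH by apply Hv'; assumption.
    + intro Hv; exists (pi a b v); rewrite pi_nm by assumption.
      rewrite IH by apply Hv; eauto.
  - destruct (classic (x = a)) as [->|H1].
    { rewrite pi_left by assumption; apply pi_right, Hb. }
    destruct (classic (x = b)) as [->|H2].
    { rewrite pi_right by assumption; apply pi_left, Ha. }
    rewrite (pi_other a b x) by assumption; now apply pi_other.
Qed.

Lemma pi_inj x y : pi a b x = pi a b y -> x = y.
Proof. intro H; rewrite <- (pi_involutive x), H; apply pi_involutive. Qed.

Lemma pi_set_iff x : emp ∈ pi a b x <-> emp ∈ x.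
Proof.
  split; [|apply pi_set]; intro H; rewrite <- (pi_involutive x); now apply pi_set.
Qed.

Lemma pi_nm_iff v y : nm (pi a b v) (pi a b y) <-> nm v y.
Proof.
  destruct (classic (emp ∈ y)) as [Hy|Hy].
  - rewrite pi_nm by assumption; split; [|eauto].
    intros (w & Hw & E); now apply pi_inj in E as ->.
  - split; intros (_ & H & _); [|contradiction]; now rewrite pi_set_iff in H.
Qed.

Lemma pi_fix u : ~ rt a u -> ~ rt b u -> pi a b u = u.
Proof.
  revert u; apply (mem_induction (fun u => ~ rt a u -> ~ rt b u -> pi a b u = u)).
  intros u IH H1 H2; destruct (classic (emp ∈ u)) as [Hu|Hu].
  - assert (A : forall v, nm v u -> pi a b v = v).
    { intros v Hv; apply IH; [apply Hv| |];
        intro A; [apply H1|apply H2]; now apply rt_step with v. }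
    apply nset_ext; [now apply pi_set|assumption|]; intro v.
    rewrite pi_nm by assumption; split.
    + intros (w & Hw & ->); now rewrite A.
    + intro Hv; exists v; now rewrite A.
  - apply pi_other; [assumption| |]; intros ->; [apply H1|apply H2]; apply rt_refl.
Qed.

Lemma rt_pi c u : rt c u -> rt (pi a b c) (pi a b u).
Proof.
  revert u; apply (rt_ind c (fun u => rt (pi a b c) (pi a b u))); [apply rt_refl|].
  intros v y Hv _; apply rt_step; now apply pi_nm_iff.
Qed.

Lemma pi_conj c d u : atom c -> atom d ->
  pi a b (pi c d u) = pi (pi a b c) (pi a b d) (pi a b u).
Proof.
  intros Hc Hd; revert u.
  apply (mem_induction
    (fun u => pi a b (pi c d u) = pi (pi a b c) (pi a b d) (pi a b u))).
  intros u IH; destruct (classic (emp ∈ u)) as [Hu|Hu].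
  - assert (A : forall x y, emp ∈ y -> forall z, atom x -> forall x', atom x' ->
      (nm z (pi x x' y) <-> exists v, nm v y /\ z = pi x x' v)).
    { intros x y Hy z Hx x' Hx'; clear - HM Hx Hx' Hy.
      unfold nm; rewrite (pi_mem x x' y Hy z); split.
      - intros (H & _ & [H'|(v & Hv & ->)]); [contradiction|]; exists v.
        repeat split; auto; intros ->; apply H, pi_other; [apply emp_spec| |];
          intro E;
          [exact (proj1 Hx (eq_sym E))|exact (proj1 Hx' (eq_sym E))].
      - intros (v & (H1 & _ & H2) & ->); repeat split; eauto.
        + destruct (atom_or_set v H1) as [B|B];
            [|now apply emp_neq_of_mem, pi_set].
          destruct (classic (v = x)) as [->|E1];
            [rewrite pi_left by apply Hx; apply Hx'|].
          destruct (classic (v = x')) as [->|E2];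
            [rewrite pi_right by apply Hx'; apply Hx|].
          rewrite pi_other by (assumption || apply B); assumption.
        + now apply pi_set. }
    apply nset_ext; [now do 2 apply pi_set|now do 2 apply pi_set|]; intro z.
    rewrite pi_nm by now apply pi_set.
    rewrite A by (now apply pi_set || now apply pi_atom).
    split; intros (w & Hw & ->).
    + apply A in Hw as (v & Hv & ->); auto.
      exists (pi a b v); rewrite pi_nm_iff; split; [assumption|]; apply IH, Hv.
    + apply pi_nm in Hw as (v & Hv & ->); auto.
      exists (pi c d v); rewrite A by auto; split; [eauto|].
      symmetry; apply IH, Hv.
  - destruct (classic (u = c)) as [->|H1].
    { rewrite !pi_left; [reflexivity|apply pi_atom, Hc|apply Hc]. }
    destruct (classic (u = d)) as [->|H2].
    { rewrite !pi_right; [reflexivity|apply pi_atom, Hd|apply Hd]. }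
    rewrite (pi_other c d) by assumption; symmetry; apply pi_other.
    + now rewrite pi_set_iff.
    + intro E; now apply pi_inj in E.
    + intro E; now apply pi_inj in E.
Qed.
End Swap.

(** ** Pure sets *)

Definition j (x : V) : V := rec (fun _ _ g => cup (ran g) (sg emp)) emp x.

#[export] Instance j_definable : DefinableFun1 j.
Proof.
  pose proof (rec_definable (fun _ _ g => cup (ran g) (sg emp))) as H.
  unfold j; definability.
Qed.

Lemma j_spec x w : w ∈ j x <-> w = emp \/ exists v, v ∈ x /\ w = j v.
Proof.
  unfold j.
  destruct (rec_unfold (fun _ _ g => cup (ran g) (sg emp)) emp x) as (g & _ & Hg & ->).
  rewrite cup_spec, ran_spec, sg_spec.
  split; intros [H|H]; auto.
  - destruct H as [v Hv]; apply Hg in Hv; eauto.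
  - destruct H as [v Hv]; left; exists v; now apply Hg.
Qed.

Lemma j_set x : emp ∈ j x.
Proof. apply j_spec; auto. Qed.

Lemma j_nm x w : nm w (j x) <-> exists v, v ∈ x /\ w = j v.
Proof.
  unfold nm; rewrite (j_spec x w); split.
  - intros (H1 & _ & [H2|H2]); [contradiction|assumption].
  - intros (v & Hv & ->); repeat split; eauto using j_set, emp_neq_of_mem.
Qed.

Lemma j_inj x y : j x = j y -> x = y.
Proof.
  revert x y; apply (mem_induction (fun x => forall y, j x = j y -> x = y)).
  intros x IH y E; apply set_ext; intro z; split; intro Hz.
  - assert (A : nm (j z) (j y)) by (rewrite <- E; apply j_nm; eauto).
    apply j_nm in A as (v & Hv & A); now rewrite (IH z Hz v A).
  - assert (A : nm (j z) (j x)) by (rewrite E; apply j_nm; eauto).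
    apply j_nm in A as (v & Hv & A); now rewrite <- (IH v Hv z (eq_sym A)).
Qed.

Lemma j_mem x y : nm (j x) (j y) <-> x ∈ y.
Proof.
  rewrite j_nm; split; [|eauto]; intros (v & Hv & E); now apply j_inj in E as ->.
Qed.

Lemma j_pure a x : atom a -> ~ rt a (j x).
Proof.
  intro Ha; revert x; apply (mem_induction (fun x => ~ rt a (j x))); intros x IH H.
  apply rt_set in H as (v & Hv & H); [|assumption|apply j_set].
  apply j_nm in Hv as (y & Hy & ->); exact (IH y Hy H).
Qed.

Lemma pi_j a b x : atom a -> atom b -> pi a b (j x) = j x.
Proof. intros Ha Hb; apply pi_fix; auto; now apply j_pure. Qed.

(** ** Small kernels *)

Definition prod (x y : V) : V :=
  sep (fun p => exists u v, u ∈ x /\ v ∈ y /\ p = op u v) (pw (pw (cup x y))).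

Lemma prod_spec x y p : p ∈ prod x y <-> exists u v, u ∈ x /\ v ∈ y /\ p = op u v.
Proof.
  unfold prod; rewrite (sep_spec _); split; [tauto|].
  intros (u & v & Hu & Hv & ->); split; [|eauto].
  apply pw_spec; intros z Hz; apply pw_spec; intros w Hw; apply cup_spec.
  unfold op in Hz; apply up_spec in Hz as [-> | ->];
    [apply sg_spec in Hw|apply up_spec in Hw]; intuition congruence.
Qed.

Lemma prod_op x y u v : op u v ∈ prod x y <-> u ∈ x /\ v ∈ y.
Proof.
  rewrite prod_spec; split; [|intros [? ?]; eauto 6].
  intros (u' & v' & Hu & Hv & E); now apply op_inj in E as [-> ->].
Qed.

#[export] Instance prod_definable : DefinableFun2 prod.
Proof.
  apply (definable_fun2_of_mem _ (fun p x y => exists u v, u ∈ x /\ v ∈ y /\ p = op u v)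
    prod_spec); definability.
Qed.

(* [Q] indexes the unions under which smallness is closed. *)
Record index_set (Q K : V) : Prop := {
  index_emp : emp ∈ Q;
  index_one : sg emp ∈ Q;
  code_emp : emp ∉ K;
  code_inhabited : exists k, k ∈ K;
  code_op : forall q k, q ∈ Q -> k ∈ K -> op q k ∈ K
}.

Lemma index_set_exists Q0 : exists Q K, (forall q, q ∈ Q0 -> q ∈ Q) /\ index_set Q K.
Proof.
  exists (cup Q0 (up emp (sg emp))).
  set (Q := cup Q0 (up emp (sg emp))).
  assert (HF : DefinableFun1 (fun k => img (fun q p => p = op q k) Q)).
  { apply (definable_fun1_of_mem _ (fun p k => exists q, q ∈ Q /\ p = op q k));
      [|definability].
    intros k p; now apply (fimg_spec (fun q => op q k)). }
  destruct (closure_exists (fun k => img (fun q p => p = op q k) Q) (sg emp))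
    as (K & HK0 & HK).
  exists (sep (fun k => k <> emp) K); split; [intros; apply cup_spec; auto|].
  assert (HK' : forall k, k ∈ sep (fun k => k <> emp) K <-> k ∈ K /\ k <> emp)
    by (intro; rewrite (sep_spec _); tauto).
  split.
  - apply cup_spec; right; apply up_spec; auto.
  - apply cup_spec; right; apply up_spec; auto.
  - rewrite HK'; tauto.
  - exists (sg emp); apply HK'; split; [assumption|].
    apply emp_neq_of_mem; now apply sg_spec.
  - intros q k Hq Hk; apply HK' in Hk as [Hk _]; apply HK'; split.
    + apply (HK k); [assumption|]; apply (fimg_spec (fun q => op q k)); eauto.
    + intro E; apply (emp_spec (sg q)); rewrite <- E; unfold op; apply up_spec; auto.
Qed.

Section Small.
Context {Q K : V} (HQK : index_set Q K).

(* [r] codes the family of the sets [{c ∈ K | (k, c) ∈ r}], [k ∈ K]; it covers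
   [u] when every urelement in the kernel of [u] has its trace on [K] among them. *)
Definition cov (r u : V) : Prop := forall a, atom a -> rt a u ->
  exists k, k ∈ K /\ forall c, c ∈ K -> (c ∈ a <-> op k c ∈ r).

#[export] Instance cov_definable : Definable2 cov.
Proof. unfold cov; definability. Qed.

Definition small (u : V) : Prop := exists r, cov r u.
Definition nob (u : V) : Prop := u <> emp /\ small u.

#[export] Instance small_definable : Definable1 small.
Proof. unfold small; definability. Qed.
#[export] Instance nob_definable : Definable1 nob.
Proof. unfold nob; definability. Qed.

Lemma cov_set r y : emp ∈ y -> (forall v, nm v y -> cov r v) -> cov r y.
Proof.
  intros Hy H a Ha Hr; apply rt_set in Hr as (v & Hv & Hr); auto.
  now apply (H v Hv).
Qed.

Lemma cov_mono r u u' : (forall a, atom a -> rt a u -> rt a u') -> cov r u' -> cov r u.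
Proof. intros H Hc a Ha Hr; apply Hc; auto. Qed.

Lemma nob_nm v y : nm v y -> nob y -> nob v.
Proof.
  intros Hv [_ [r Hr]]; split; [apply Hv|]; exists r.
  apply cov_mono with y; [|assumption]; intros a _ Ha; now apply rt_step with v.
Qed.

Lemma nob_atom a : atom a -> nob a.
Proof.
  intro Ha; split; [apply Ha|].
  exists (sep (fun p => exists k c, p = op k c /\ c ∈ a) (prod K K)).
  intros b Hb Hr; apply rt_inv in Hr as [<-|(v & (_ & H & _) & _)]; [|now destruct Ha].
  destruct (code_inhabited _ _ HQK) as [k Hk]; exists k; split; [assumption|].
  intros c Hc; rewrite (sep_spec _), prod_op; split.
  - intro; split; [now split|eauto].
  - intros [_ (k' & c' & E & H)]; now apply op_inj in E as [_ ->].
Qed.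

Lemma nob_j x : nob (j x).
Proof.
  split; [apply emp_neq_of_mem, j_set|]; exists emp; intros a Ha Hr.
  now apply j_pure in Hr.
Qed.

Lemma cov_family (HAC : AC M) (R : V -> V -> Prop) {HR : Definable2 R} :
  (forall q u u', R q u -> R q u' -> u = u') ->
  exists r, forall q u, q ∈ Q -> R q u -> small u -> cov r u.
Proof.
  intro Hfun; set (P := pw (prod K K)).
  destruct (HAC P (no_ur P)) as (W & _ & HW1 & HW2 & _ & HW4).
  assert (A : forall u, small u -> exists r, r ∈ P /\ cov r u).
  { intros u [r Hr]; exists (sep (fun p => p ∈ r) (prod K K)); split.
    - apply pw_spec; intros p Hp; rewrite (sep_spec _) in Hp; tauto.
    - intros a Ha Hra; destruct (Hr a Ha Hra) as (k & Hk & H).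
      exists k; split; [assumption|]; intros c Hc.
      rewrite (sep_spec _), prod_op, (H c Hc); tauto. }
  pose (L u r := r ∈ P /\ cov r u /\
    forall r', r' ∈ P -> cov r' u -> r = r' \/ op r r' ∈ W).
  assert (HL : Definable2 L) by (unfold L; definability).
  assert (L1 : forall u, small u -> exists r, L u r).
  { intros u Hu; destruct (A _ Hu) as (r0 & Hr0 & Hc0).
    assert (HS : forall r, r ∈ sep (fun r => cov r u) P <-> r ∈ P /\ cov r u)
      by (intro; rewrite (sep_spec _); tauto).
    destruct (HW4 (sep (fun r => cov r u) P)) as (r & Hr & Hmin).
    - apply no_ur.
    - intros r Hr; now apply HS in Hr.
    - exists r0; now apply HS.
    - apply HS in Hr as [Hr Hc]; exists r; repeat split; auto.
      intros r' Hr' Hc'; rewrite <- srel_op; apply Hmin, HS; auto. }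
  assert (L2 : forall u r r', L u r -> L u r' -> r = r').
  { intros u r r' (H1 & H2 & H3) (H1' & H2' & H3').
    destruct (H3 r' H1' H2') as [|B]; [assumption|].
    destruct (H3' r H1 H2) as [|B']; [now symmetry|].
    apply srel_op in B, B'; destruct (HW1 r H1); now apply (HW2 r r' r). }
  exists (sep (fun p => exists q k c u r, p = op (op q k) c /\ R q u /\ L u r /\
    op k c ∈ r) (prod K K)).
  intros q u Hq Hqu Hs a Ha Hra; destruct (L1 u Hs) as [r Hr].
  destruct (proj1 (proj2 Hr) a Ha Hra) as (k & Hk & H).
  exists (op q k); split; [now apply (code_op _ _ HQK)|]; intros c Hc.
  rewrite (sep_spec _), prod_op, (H c Hc); split.
  - intro; split; [split; [now apply (code_op _ _ HQK)|assumption]|].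
    exists q, k, c, u, r; auto.
  - intros [_ (q' & k' & c' & u' & r' & E & Hu' & Hr' & H')].
    apply op_inj in E as [E <-]; apply op_inj in E as [<- <-].
    rewrite <- (Hfun q u u' Hqu Hu') in Hr'; now rewrite (L2 u r r').
Qed.

Lemma cov_pair (HAC : AC M) u v : small u -> small v -> exists r, cov r u /\ cov r v.
Proof.
  intros Hu Hv.
  assert (H01 : sg emp <> emp) by (apply emp_neq_of_mem; now apply sg_spec).
  destruct (cov_family HAC (fun q x => (q = emp /\ x = u) \/ (q = sg emp /\ x = v)))
    as [r Hr].
  - intros q x x' [[-> ->]|[-> ->]] [[E ->]|[E ->]]; congruence.
  - exists r; split.
    + apply (Hr emp u); auto; apply HQK.
    + apply (Hr (sg emp) v); auto; apply HQK.
Qed.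

(* Every column is a proper class: it has members outside any given kernel. *)
Lemma fresh_atom s t : subset M s K ->
  exists b, atom b /\ (forall c, c ∈ K -> (c ∈ b <-> c ∈ s)) /\ ~ rt b t.
Proof.
  intro Hs; set (z := up K t); exists (cup s (sg z)).
  assert (Hz : z ∈ cup s (sg z)) by (apply cup_spec; right; now apply sg_spec).
  repeat split.
  - intro E; rewrite E in Hz; now apply emp_spec in Hz.
  - intro H; apply cup_spec in H as [H|H].
    + now apply (code_emp _ _ HQK), Hs.
    + apply sg_spec in H; apply (emp_spec K); rewrite H; apply up_spec; auto.
  - intro H'; apply cup_spec in H' as [H'|H']; [assumption|].
    apply sg_spec in H' as ->; destruct (no_2cycle K z); [|assumption].
    apply up_spec; auto.
  - intro; apply cup_spec; auto.
  - intro H; apply rt_rle in H; apply (mem_not_rle z _ Hz).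
    apply rle_trans with t; [assumption|]; apply mem_rle, up_spec; auto.
Qed.

Definition same (a b : V) : Prop := forall c, c ∈ K -> (c ∈ a <-> c ∈ b).

#[export] Instance same_definable : Definable2 same.
Proof. unfold same; definability. Qed.

Lemma same_pi a b c : atom a -> atom b -> same a b -> atom c -> same (pi a b c) c.
Proof.
  intros Ha Hb Hab Hc.
  destruct (classic (c = a)) as [->|H1].
  { rewrite pi_left by apply Ha; intros k Hk; symmetry; auto. }
  destruct (classic (c = b)) as [->|H2].
  { rewrite pi_right by apply Hb; intros k Hk; auto. }
  rewrite pi_other by (assumption || apply Hc); intros k _; tauto.
Qed.

Lemma cov_pi a b r u : atom a -> atom b -> same a b -> cov r u -> cov r (pi a b u).
Proof.
  intros Ha Hb Hab H c Hc Hr.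
  apply (rt_pi Ha Hb) in Hr; rewrite pi_involutive in Hr by assumption.
  destruct (H _ (pi_atom Ha Hb c Hc) Hr) as (k & Hk & Hkc).
  exists k; split; [assumption|]; intros x Hx; rewrite <- (Hkc x Hx).
  symmetry; now apply same_pi.
Qed.

Lemma nob_pi a b u : atom a -> atom b -> same a b -> nob u -> nob (pi a b u).
Proof.
  intros Ha Hb Hab [Hu [r Hr]]; split; [now apply pi_neq_emp|].
  exists r; now apply cov_pi.
Qed.

Definition supports (e : V) (X : cls M) : Prop := forall a b, atom a -> atom b ->
  same a b -> ~ rt a e -> ~ rt b e ->
  forall u, cmem M u X -> cmem M (pi a b u) X.

Definition ncls (X : cls M) : Prop :=
  (forall u, cmem M u X -> nob u) /\ exists e, nob e /\ supports e X.

Lemma definable_ncls i : definable (fun e E => ncls (E i)).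
Proof. unfold ncls, supports; definability. Qed.

Lemma supports_mono e e' X : (forall a, atom a -> rt a e -> rt a e') ->
  supports e X -> supports e' X.
Proof. intros H HX a b Ha Hb Hs H1 H2; apply HX; auto. Qed.

Lemma supports_pi a b e X X' : atom a -> atom b -> same a b ->
  (forall u, cmem M u X' <-> cmem M (pi a b u) X) ->
  supports e X -> supports (pi a b e) X'.
Proof.
  intros Ha Hb Hab HX' H c d Hc Hd Hcd Hce Hde u Hu.
  apply HX'; apply HX' in Hu; rewrite pi_conj by assumption.
  apply H; auto using pi_atom.
  - intros k Hk.
    rewrite (same_pi a b c Ha Hb Hab Hc k Hk), (same_pi a b d Ha Hb Hab Hd k Hk).
    now apply Hcd.
  - intro A; apply Hce; apply (rt_pi Ha Hb) in A; now rewrite pi_involutive in A.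
  - intro A; apply Hde; apply (rt_pi Ha Hb) in A; now rewrite pi_involutive in A.
Qed.

End Small.
End Urelements.

Arguments cov {M} K r u.
Arguments small {M} K u.
Arguments nob {M} K u.
Arguments same {M} K a b.
Arguments supports {M} K e X.
Arguments ncls {M} K X.

(** * The urelement model *)

Section Automorphism.
Context {M : structure} (f : obj M -> obj M) (g : cls M -> cls M).
Context (f_involutive : forall x, f (f x) = x).
Context (g_involutive : forall X, g (g X) = X).
Context (f_ur : forall x, ur M (f x) <-> ur M x).
Context (f_mem : forall x y, mem M (f x) (f y) <-> mem M x y).
Context (f_cmem : forall x X, cmem M (f x) (g X) <-> cmem M x X).

Lemma sat_automorphism p : forall e E,
  sat M (fun n => f (e n)) (fun n => g (E n)) p <-> sat M e E p.
Proof.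
  induction p; intros e E; simpl.
  - tauto.
  - apply f_ur.
  - split; [|congruence]; intro H.
    now rewrite <- (f_involutive (e x)), H, f_involutive.
  - apply f_mem.
  - split; [|congruence]; intro H.
    now rewrite <- (g_involutive (E X)), H, g_involutive.
  - apply f_cmem.
  - now rewrite IHp1, IHp2.
  - split; intros H a.
    + apply IHp; rewrite (update_comp f); apply H.
    + rewrite <- (f_involutive a), <- (update_comp f e); apply IHp, H.
  - split; intros H A.
    + apply IHp; rewrite (update_comp g); apply H.
    + rewrite <- (g_involutive A), <- (update_comp g E); apply IHp, H.
Qed.
End Automorphism.

Section Model.
Context {M : structure} {HM : KM M} (HAC : AC M).
Context {Q K : obj M} (HQK : index_set Q K).
Notation V := (obj M).
Local Notation "x ∈ y" := (mem M x y) (at level 70).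
Local Notation "x ∉ y" := (~ mem M x y) (at level 70).

Lemma ncls_inhabited : inhabited {X : cls M | ncls K X}.
Proof.
  destruct (class_of (fun _ => False)) as [X HX]; constructor; exists X; split.
  - intros u Hu; now apply HX in Hu.
  - exists (j emp); split; [apply nob_j|]; intros a b _ _ _ _ _ u Hu.
    now apply HX in Hu.
Qed.

Definition urelement_model : structure := {|
  obj := {u : V | nob K u};
  cls := {X : cls M | ncls K X};
  ur u := emp ∉ proj1_sig u;
  mem u v := nm (proj1_sig u) (proj1_sig v);
  cmem u X := cmem M (proj1_sig u) (proj1_sig X);
  obj_inhabited := inhabits (exist _ (j emp) (nob_j emp));
  cls_inhabited := ncls_inhabited
|}.

Notation N := urelement_model.
Definition val (u : obj N) : V := proj1_sig u.
Definition cval (X : cls N) : cls M := proj1_sig X.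
Definition mk (u : V) (H : nob K u) : obj N := exist _ u H.
Definition cmk (X : cls M) (H : ncls K X) : cls N := exist _ X H.

Lemma val_nob u : nob K (val u).
Proof. exact (proj2_sig u). Qed.

Lemma val_neq u : val u <> emp.
Proof. apply val_nob. Qed.

Lemma val_inj u v : val u = val v -> u = v.
Proof. apply eq_sig_hprop; intros; apply proof_irrelevance. Qed.

Lemma cval_inj X Y : cval X = cval Y -> X = Y.
Proof. apply eq_sig_hprop; intros; apply proof_irrelevance. Qed.

Lemma N_mem u v : mem N u v <-> nm (val u) (val v).
Proof. reflexivity. Qed.

Lemma N_cmem u X : cmem N u X <-> cmem M (val u) (cval X).
Proof. reflexivity. Qed.

Lemma N_is_set u : is_set N u <-> emp ∈ val u.
Proof. unfold is_set; simpl; split; [apply NNPP|tauto]. Qed.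

Lemma nm_lift v y : nm v (val y) -> exists v', val v' = v.
Proof.
  intro H; exists (mk v (nob_nm _ _ H (val_nob y))); reflexivity.
Qed.

(** ** Pairs of the model *)

Definition ns (s : V) : V := cup s (sg emp).
Definition nup (x y : V) : V := ns (up x y).
Definition nop (x y : V) : V := nup (nup x x) (nup x y).

Instance ns_definable : DefinableFun1 ns.
Proof. unfold ns; definability. Qed.
Instance nup_definable : DefinableFun2 nup.
Proof. unfold nup; definability. Qed.
Instance nop_definable : DefinableFun2 nop.
Proof. unfold nop; definability. Qed.

Lemma ns_set s : emp ∈ ns s.
Proof. apply cup_spec; right; now apply sg_spec. Qed.

Lemma ns_nm s v : nm v (ns s) <-> v <> emp /\ v ∈ s.
Proof.
  pose proof (ns_set s) as H; revert H; unfold nm, ns.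
  rewrite (cup_spec s (sg emp) v), sg_spec; tauto.
Qed.

Lemma ns_neq s : ns s <> emp.
Proof. apply emp_neq_of_mem, ns_set. Qed.

Lemma ns_nob s r : (forall v, v ∈ s -> cov K r v) -> nob K (ns s).
Proof.
  intro H; split; [apply ns_neq|]; exists r; apply cov_set; [apply ns_set|].
  intros v Hv; now apply H, ns_nm.
Qed.

Lemma nup_nm x y v : nm v (nup x y) <-> v <> emp /\ (v = x \/ v = y).
Proof. unfold nup; now rewrite ns_nm, up_spec. Qed.

Lemma nup_nob x y : nob K x -> nob K y -> nob K (nup x y).
Proof.
  intros [_ Hx] [_ Hy]; destruct (cov_pair HQK HAC x y Hx Hy) as (r & Hrx & Hry).
  apply (ns_nob _ r); intros v Hv; now apply up_spec in Hv as [-> | ->].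
Qed.

Lemma nop_nob x y : nob K x -> nob K y -> nob K (nop x y).
Proof. intros; apply nup_nob; now apply nup_nob. Qed.

Lemma rt_nup a x y : atom a -> rt a (nup x y) -> rt a x \/ rt a y.
Proof.
  intros Ha H; apply rt_set in H as (v & Hv & H); [|assumption|apply ns_set].
  apply nup_nm in Hv as [_ [-> | ->]]; auto.
Qed.

Lemma rt_nop a x y : atom a -> rt a (nop x y) -> rt a x \/ rt a y.
Proof.
  intros Ha H; apply rt_nup in H as [H|H]; auto; apply rt_nup in H; tauto.
Qed.

Lemma cov_nop r x y : cov K r x -> cov K r y -> cov K r (nop x y).
Proof. intros Hx Hy a Ha H; apply rt_nop in H as [H|H]; auto. Qed.

Lemma nup_inj x y y' : y <> emp -> y' <> emp -> nup x y = nup x y' -> y = y'.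
Proof.
  intros Hy Hy' H.
  assert (A : nm y (nup x y')) by (rewrite <- H; apply nup_nm; auto).
  assert (B : nm y' (nup x y)) by (rewrite H; apply nup_nm; auto).
  apply nup_nm in A, B; intuition congruence.
Qed.

Lemma nop_inj x y x' y' : x <> emp -> y <> emp -> x' <> emp -> y' <> emp ->
  nop x y = nop x' y' -> x = x' /\ y = y'.
Proof.
  intros Hx Hy Hx' Hy' H.
  assert (x = x') as <-.
  { assert (A : nm (nup x' x') (nop x y)).
    { rewrite H; apply nup_nm; split; [apply ns_neq|auto]. }
    assert (B : nm x (nup x' x')).
    { apply nup_nm in A as [_ [-> | ->]]; apply nup_nm; auto. }
    apply nup_nm in B; tauto. }
  split; [reflexivity|].
  apply nup_inj in H; [|apply ns_neq|apply ns_neq]; now apply nup_inj in H.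
Qed.

Lemma N_upair z x y : is_upair N z x y <-> val z = nup (val x) (val y).
Proof.
  split.
  - intro H; apply nset_ext.
    + apply (proj2 (H x)); auto.
    + apply ns_set.
    + intro v; rewrite nup_nm; split.
      * intro Hv; destruct (nm_lift v z Hv) as [w <-].
        split; [apply val_neq|]; destruct (proj1 (H w) Hv) as [-> | ->]; auto.
      * intros [_ [-> | ->]]; apply H; auto.
  - intros H w; rewrite N_mem, H, nup_nm; split.
    + intros [_ [E|E]]; apply val_inj in E; auto.
    + intros [-> | ->]; split; auto using val_neq.
Qed.

Lemma N_pair p x y : is_pair N p x y <-> val p = nop (val x) (val y).
Proof.
  split.
  - intro H; apply nset_ext.
    + pose (q := mk _ (nup_nob (val x) (val x) (val_nob x) (val_nob x))).
      apply (proj2 (H q)); left; now apply N_upair.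
    + apply ns_set.
    + intro v; unfold nop; rewrite nup_nm; split.
      * intro Hv; destruct (nm_lift v p Hv) as [w <-].
        split; [apply val_neq|]; apply H in Hv; now rewrite !N_upair in Hv.
      * intros [_ Hv].
        assert (A : exists w, val w = v).
        { destruct Hv as [-> | ->];
            eexists (mk _ (nup_nob _ _ (val_nob _) (val_nob _))); reflexivity. }
        destruct A as [w <-]; apply H; now rewrite !N_upair.
  - intros H z; rewrite N_mem, H, !N_upair; unfold nop; rewrite nup_nm.
    split; [tauto|]; intro; split; [apply val_neq|assumption].
Qed.

Lemma N_srel r x y : srel N r x y <-> nm (nop (val x) (val y)) (val r).
Proof.
  split.
  - intros (p & Hp & H); apply N_pair in Hp; now rewrite <- Hp.
  - intro H; exists (mk _ (nop_nob _ _ (val_nob x) (val_nob y))).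
    split; [now apply N_pair|exact H].
Qed.

Lemma N_crel R x y : crel N R x y <-> cmem M (nop (val x) (val y)) (cval R).
Proof.
  split.
  - intros (p & Hp & H); apply N_pair in Hp; now rewrite <- Hp.
  - intro H; exists (mk _ (nop_nob _ _ (val_nob x) (val_nob y))).
    split; [now apply N_pair|exact H].
Qed.

Lemma val_nop_inj x y x' y' :
  nop (val x) (val y) = nop (val x') (val y') -> x = x' /\ y = y'.
Proof.
  intro H; apply nop_inj in H as [A B]; auto using val_neq, val_inj.
Qed.

(** ** Elementary axioms *)

Lemma N_urelements_empty : Urelements_empty N.
Proof. intros x y Hx (_ & H & _); exact (Hx H). Qed.

Lemma N_extensionality : Extensionality N.
Proof.
  intros x y Hx Hy H; apply N_is_set in Hx, Hy; apply val_inj, nset_ext; auto.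
  intro v; split; intro Hv; destruct (nm_lift v _ Hv) as [w <-]; now apply (H w).
Qed.

Lemma N_foundation : Foundation N.
Proof.
  intros x [y Hy].
  assert (HS : forall v, v ∈ sep (fun v => nm v (val x)) (val x) <-> nm v (val x)).
  { intro v; rewrite (sep_spec _); split; [tauto|]; intro Hv; split; [apply Hv|assumption]. }
  destruct (foundation (sep (fun v => nm v (val x)) (val x))) as (v & Hv & Hmin).
  - exists (val y); now apply HS.
  - apply HS in Hv; destruct (nm_lift v _ Hv) as [w <-]; exists w; split; [exact Hv|].
    intros z Hz Hzx; apply (Hmin (val z)); [apply Hz|now apply HS].
Qed.

Lemma N_pairing : Pairing N.
Proof.
  intros x y; exists (mk _ (nup_nob _ _ (val_nob x) (val_nob y))).
  split; [apply N_is_set, ns_set|now apply N_upair].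
Qed.

Lemma ns_nob_below s x :
  (forall v a, v ∈ s -> atom a -> rt a v -> rt a (val x)) -> nob K (ns s).
Proof.
  intro H; destruct (val_nob x) as [_ [r Hr]]; apply (ns_nob _ r).
  intros v Hv; apply cov_mono with (val x); eauto.
Qed.

Lemma N_union : Union N.
Proof.
  intros x Hx.
  pose (P v := exists y, nm y (val x) /\ nm v y).
  assert (HP : Definable1 P) by (unfold P; definability).
  assert (HS : forall v, v ∈ sep P (un (val x)) <-> P v).
  { intro v; rewrite sep_spec by assumption; split; [tauto|]; intro Hv.
    split; [|assumption]; destruct Hv as (y & Hy & Hv); apply un_spec.
    exists y; split; [apply Hy|apply Hv]. }
  assert (HN : nob K (ns (sep P (un (val x))))).
  { apply (ns_nob_below _ x); intros v a Hv Ha Hr.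
    apply HS in Hv as (y & Hy & Hv); eauto using rt_step. }
  exists (mk _ HN); split; [apply N_is_set, ns_set|].
  intro z; rewrite N_mem; simpl; rewrite ns_nm, HS; split.
  - intros [_ (y & Hy & Hz)]; destruct (nm_lift y x Hy) as [y' <-]; now exists y'.
  - intros (y & Hy & Hz); split; [apply val_neq|now exists (val y)].
Qed.

Lemma N_powerset : Powerset N.
Proof.
  intros x Hx; apply N_is_set in Hx.
  pose (P v := emp ∈ v).
  assert (HP : Definable1 P) by (unfold P; definability).
  assert (HS : forall v, v ∈ sep P (pw (val x)) <-> emp ∈ v /\ subset M v (val x)).
  { intro v; rewrite sep_spec, pw_spec by assumption; unfold P; tauto. }
  assert (HN : nob K (ns (sep P (pw (val x))))).
  { apply (ns_nob_below _ x); intros v a Hv Ha Hr; apply HS in Hv as [H0 Hv].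
    apply rt_set in Hr as (w & (Hw & _ & Hwv) & Hr); auto.
    apply rt_step with w; [|assumption]; repeat split; auto. }
  exists (mk _ HN); split; [apply N_is_set, ns_set|].
  intro z; rewrite N_mem; simpl; rewrite ns_nm, HS, N_is_set; split.
  - intros [_ [H0 Hz]]; split; [assumption|]; intros w (Hw & _ & Hwz).
    repeat split; auto.
  - intros [H0 Hz]; split; [apply val_neq|]; split; [assumption|]; intros w Hw.
    destruct (classic (w = emp)) as [->|Hwe]; [assumption|].
    assert (A : nm w (val z)) by (repeat split; assumption).
    destruct (nm_lift w z A) as [w' <-]; now apply (Hz w').
Qed.

Definition jN (x : V) : obj N := mk (j x) (nob_j x).

Lemma jN_mem x y : mem N (jN x) (jN y) <-> x ∈ y.
Proof. apply j_mem. Qed.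

Lemma jN_mem_inv w y : mem N w (jN y) <-> exists x, x ∈ y /\ w = jN x.
Proof.
  rewrite N_mem; simpl; rewrite j_nm; split; intros (x & Hx & E); exists x;
    (split; [assumption|]); [now apply val_inj|now rewrite E].
Qed.

Lemma jN_is_set x : is_set N (jN x).
Proof. apply N_is_set, j_set. Qed.

Lemma jN_inj x y : jN x = jN y -> x = y.
Proof. intro E; apply j_inj; exact (f_equal val E). Qed.

Lemma N_infinity : Infinity N.
Proof.
  destruct inductive_set_exists as (i & Hi0 & HiS).
  exists (jN i); split; [apply jN_is_set|]; split.
  - exists (jN emp); split; [now apply jN_mem|]; split; [apply jN_is_set|].
    intros w Hw; apply jN_mem_inv in Hw as (x & Hx & _); now apply emp_spec in Hx.
  - intros w Hw; apply jN_mem_inv in Hw as (x & Hx & ->).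
    exists (jN (suc x)); split; [apply jN_mem; auto|]; intro w.
    rewrite !jN_mem_inv; split.
    + intros (y & Hy & ->); apply suc_spec in Hy as [Hy | ->]; eauto.
    + intros [(y & Hy & ->) | ->]; eexists; (split; [|reflexivity]);
        apply suc_spec; auto.
Qed.

Lemma N_separation : Separation N.
Proof.
  intros Y x Hx.
  pose (P v := cmem M v (cval Y) /\ nm v (val x)).
  assert (HP : Definable1 P) by (unfold P; definability).
  assert (HS : forall v, v ∈ sep P (val x) <-> P v).
  { intro v; rewrite sep_spec by assumption; split; [tauto|]; intro Hv.
    split; [apply Hv|assumption]. }
  assert (HN : nob K (ns (sep P (val x)))).
  { apply (ns_nob_below _ x); intros v a Hv Ha Hr; apply HS in Hv as [_ Hv].
    eauto using rt_step. }
  exists (mk _ HN); split; [apply N_is_set, ns_set|].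
  intro z; rewrite N_mem; simpl; rewrite ns_nm, HS; unfold P.
  split; [tauto|]; intro H; split; [apply (val_neq z)|exact H].
Qed.

Lemma N_class_extensionality : Class_Extensionality N.
Proof.
  intros X Y H; apply cval_inj.
  destruct HM as ((_ & HE & _) & _); apply HE; intro u.
  destruct (proj2_sig X) as [HX _], (proj2_sig Y) as [HY _].
  split; intro Hu.
  - exact (proj1 (H (mk u (HX u Hu))) Hu).
  - exact (proj2 (H (mk u (HY u Hu))) Hu).
Qed.

(** ** Replacement *)

Lemma pi_nup a b x y : atom a -> atom b -> x <> emp -> y <> emp ->
  pi a b (nup x y) = nup (pi a b x) (pi a b y).
Proof.
  intros Ha Hb Hx Hy; apply nset_ext; [apply pi_set, ns_set|apply ns_set|].
  intro v; rewrite pi_nm by (assumption || apply ns_set); rewrite nup_nm; split.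
  - intros (w & Hw & ->); apply nup_nm in Hw as [Hw [-> | ->]];
      split; auto using pi_neq_emp.
  - intros [Hv [-> | ->]]; [exists x|exists y]; rewrite nup_nm; auto.
Qed.

Lemma pi_nop a b x y : atom a -> atom b -> x <> emp -> y <> emp ->
  pi a b (nop x y) = nop (pi a b x) (pi a b y).
Proof.
  intros Ha Hb Hx Hy; unfold nop; now rewrite !pi_nup by (assumption || apply ns_neq).
Qed.

(* A value of a class function is fixed by the transpositions fixing the support
   of the function and the argument, so it has no further urelements. *)
Lemma kernel_of_value F e x y a : supports K e F -> nob K e ->
  (forall y', nob K y' -> cmem M (nop x y') F -> y' = y) ->
  nob K x -> nob K y -> cmem M (nop x y) F ->
  atom a -> rt a y -> rt a e \/ rt a x.
Proof.
  intros HF He Hfun Hx Hy Hxy Ha Hr; apply NNPP; intro H.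
  destruct (fresh_atom HQK (sep (fun c => c ∈ a) K) (nup y (nup e x)))
    as (b & Hb & Hab & Hbr).
  { intros c Hc; rewrite (sep_spec _) in Hc; tauto. }
  assert (Hs : same K a b).
  { intros c Hc; rewrite (Hab c Hc), (sep_spec _); tauto. }
  assert (Hbex : ~ rt b (nup e x)).
  { intro A; apply Hbr; apply rt_step with (nup e x); [|assumption].
    apply nup_nm; split; [apply ns_neq|auto]. }
  assert (Hbe : ~ rt b e).
  { intro A; apply Hbex; apply rt_step with e; [|assumption].
    apply nup_nm; split; [apply He|auto]. }
  assert (Hbx : ~ rt b x).
  { intro A; apply Hbex; apply rt_step with x; [|assumption].
    apply nup_nm; split; [apply Hx|auto]. }
  assert (A : pi a b y = y).
  { apply Hfun; [now apply nob_pi|].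
    rewrite <- (pi_fix Ha Hb x) by tauto.
    rewrite <- pi_nop by (assumption || apply Hx || apply Hy).
    apply HF; tauto. }
  apply Hbr; apply rt_step with y; [apply nup_nm; split; [apply Hy|auto]|].
  apply (rt_pi Ha Hb) in Hr; rewrite A, pi_left in Hr; [assumption|apply Ha].
Qed.

Lemma N_replacement : Replacement N.
Proof.
  intros F Hfun w Hw.
  assert (HF : forall x y y', nob K x -> nob K y -> nob K y' ->
    cmem M (nop x y) (cval F) -> cmem M (nop x y') (cval F) -> y = y').
  { intros x y y' Hx Hy Hy' H H'.
    enough (E : mk y Hy = mk y' Hy') by exact (f_equal val E).
    apply (Hfun (mk x Hx)); now apply N_crel. }
  pose (R x y := nm x (val w) /\ nob K y /\ cmem M (nop x y) (cval F)).
  assert (HR : Definable2 R) by (unfold R; definability).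
  assert (HI : forall y, y ∈ img R (val w) <-> exists x, x ∈ val w /\ R x y).
  { intro y; apply img_spec; [assumption|].
    intros x y1 y2 _ (Hx & Hy1 & H1) (_ & Hy2 & H2).
    apply (HF x); auto; now apply nob_nm with (val w), val_nob. }
  destruct (proj2 (proj2_sig F)) as (e & He & Hsup).
  destruct (cov_pair HQK HAC e (val w)) as (r & Hre & Hrw); [apply He|apply val_nob|].
  assert (HN : nob K (ns (img R (val w)))).
  { apply (ns_nob _ r); intros y Hy a Ha Hr.
    apply HI in Hy as (x & _ & Hx & Hy & Hxy).
    assert (Hxn : nob K x) by now apply nob_nm with (val w), val_nob.
    destruct (kernel_of_value (cval F) e x y a) as [A|A]; auto.
    - intros y' Hy' H'; now apply (HF x).
    - apply Hrw; eauto using rt_step. }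
  exists (mk _ HN); split; [apply N_is_set, ns_set|].
  intro y; rewrite N_mem; simpl; rewrite ns_nm, HI; split.
  - intros [_ (x & _ & Hx & _ & Hxy)]; destruct (nm_lift x w Hx) as [x' <-].
    exists x'; split; [assumption|now apply N_crel].
  - intros (x & Hx & Hxy); split; [apply val_neq|]; exists (val x).
    split; [apply Hx|]; repeat split; try apply Hx; [apply val_neq|apply val_nob|].
    now apply N_crel.
Qed.

(** ** Comprehension *)

Fixpoint relativized (p : formula) (e : nat -> V) (E : nat -> cls M) : Prop :=
  match p with
  | FFalse => False
  | FUr x => emp ∉ e x
  | FEq x y => e x = e y
  | FMem x y => nm (e x) (e y)
  | FCEq X Y => forall z, cmem M z (E X) <-> cmem M z (E Y)
  | FCMem x X => cmem M (e x) (E X)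
  | FImp p q => relativized p e E -> relativized q e E
  | FAll x p => forall a, nob K (update e x a x) -> relativized p (update e x a) E
  | FCAll X p => forall A, ncls K (update E X A X) -> relativized p e (update E X A)
  end.

Lemma relativized_definable p : definable (relativized p).
Proof.
  induction p; simpl.
  - definability.
  - definability.
  - definability.
  - definability.
  - definability.
  - definability.
  - now apply definable_imp.
  - apply (definable_update (fun e E => nob K (e x) -> relativized p e E)).
    apply definable_imp; [definability|assumption].
  - apply (definable_cupdate (fun e E => ncls K (E X) -> relativized p e E)).
    apply definable_imp; [apply definable_ncls|assumption].
Qed.

Lemma cls_ext (X Y : cls M) : (forall z, cmem M z X <-> cmem M z Y) -> X = Y.
Proof. apply HM. Qed.

Lemma sat_relativized p : forall e E,
  sat N e E p <-> relativized p (fun n => val (e n)) (fun n => cval (E n)).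
Proof.
  induction p; intros e E; cbn [sat relativized].
  - reflexivity.
  - reflexivity.
  - split; [now intros ->|apply val_inj].
  - reflexivity.
  - split; [now intros ->|]; intro H; now apply cval_inj, cls_ext.
  - reflexivity.
  - now rewrite IHp1, IHp2.
  - split.
    + intros H a Ha; rewrite update_same in Ha.
      specialize (H (mk a Ha)); apply IHp in H.
      now rewrite (update_comp val e x (mk a Ha)) in H.
    + intros H a; apply IHp; rewrite (update_comp val e x a); apply H.
      rewrite update_same; apply val_nob.
  - split.
    + intros H A HA; rewrite update_same in HA.
      specialize (H (cmk A HA)); apply IHp in H.
      now rewrite (update_comp cval E X (cmk A HA)) in H.
    + intros H A; apply IHp; rewrite (update_comp cval E X A); apply H.
      rewrite update_same; apply (proj2_sig A).
Qed.

Lemma common_support n m (e : nat -> obj N) (E : nat -> cls N) :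
  exists s, nob K s /\
    (forall i, i < n -> forall a, atom a -> rt a (val (e i)) -> rt a s) /\
    (forall i, i < m -> supports K s (cval (E i))).
Proof.
  assert (A : forall n, exists s, nob K s /\
    forall i, i < n -> forall a, atom a -> rt a (val (e i)) -> rt a s).
  { clear n; induction n as [|n (s & Hs & IH)].
    - exists (j emp); split; [apply nob_j|lia].
    - exists (nup s (val (e n))); split; [apply nup_nob; auto using val_nob|].
      intros i Hi a Ha Hr; destruct (Nat.eq_dec i n) as [->|Hn].
      + apply rt_step with (val (e n)); [|assumption].
        apply nup_nm; split; [apply val_neq|auto].
      + apply rt_step with s; [apply nup_nm; split; [apply Hs|auto]|].
        apply (IH i); auto; lia. }
  induction m as [|m (s & Hs & IHe & IHE)].
  - destruct (A n) as (s & Hs & H); exists s; split; [assumption|]; split; [assumption|lia].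
  - destruct (proj2 (proj2_sig (E m))) as (t & Ht & Hsup).
    assert (B : forall a, rt a s -> rt a (nup s t)).
    { intros a H; apply rt_step with s; [|assumption].
      apply nup_nm; split; [apply Hs|auto]. }
    exists (nup s t); split; [now apply nup_nob|]; split; [eauto|].
    intros i Hi; destruct (Nat.eq_dec i m) as [->|Hm].
    + apply supports_mono with t; [|assumption]; intros a _ H.
      apply rt_step with t; [|assumption]; apply nup_nm; split; [apply Ht|auto].
    + apply supports_mono with s; [auto|]; apply IHE; lia.
Qed.

Section Transposition.
Context {a b : V} (Ha : atom a) (Hb : atom b) (Hab : same K a b).

Definition pi_obj (u : obj N) : obj N := mk _ (nob_pi a b _ Ha Hb Hab (val_nob u)).

Lemma pi_cls_exists (X : cls N) :
  exists Y : cls N, forall u, cmem M u (cval Y) <-> cmem M (pi a b u) (cval X).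
Proof.
  destruct (class_of (fun u => cmem M (pi a b u) (cval X))) as [Y HY].
  destruct (proj2_sig X) as [HX (e & He & Hsup)].
  assert (H : ncls K Y).
  { split.
    - intros u Hu; apply HY in Hu; rewrite <- (pi_involutive Ha Hb u).
      apply nob_pi; auto.
    - exists (pi a b e); split; [now apply nob_pi|].
      now apply supports_pi with (cval X). }
  now exists (cmk Y H).
Qed.

Definition pi_cls (X : cls N) : cls N :=
  epsilon (inhabits X)
    (fun Y => forall u, cmem M u (cval Y) <-> cmem M (pi a b u) (cval X)).

Lemma pi_cls_spec X u : cmem M u (cval (pi_cls X)) <-> cmem M (pi a b u) (cval X).
Proof. revert u; unfold pi_cls; apply epsilon_spec, pi_cls_exists. Qed.

Lemma sat_pi p e E :
  sat N (fun n => pi_obj (e n)) (fun n => pi_cls (E n)) p <-> sat N e E p.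
Proof.
  apply sat_automorphism.
  - intro u; apply val_inj; now apply pi_involutive.
  - intro X; apply cval_inj, cls_ext; intro u.
    now rewrite !pi_cls_spec, pi_involutive.
  - intro u; simpl; now rewrite pi_set_iff.
  - intros u v; now apply pi_nm_iff.
  - intros u X; rewrite !N_cmem, pi_cls_spec; simpl.
    now rewrite pi_involutive.
Qed.

Lemma pi_cls_fix s X : supports K s (cval X) -> ~ rt a s -> ~ rt b s -> pi_cls X = X.
Proof.
  intros HX H1 H2; apply cval_inj, cls_ext; intro u; rewrite pi_cls_spec; split.
  - intro H; rewrite <- (pi_involutive Ha Hb u); now apply HX.
  - intro H; now apply HX.
Qed.
End Transposition.

Lemma N_comprehension : Full_Comprehension N.
Proof.
  intros p n e E.
  pose (P x := relativized p (update (fun m => val (e m)) n x) (fun m => cval (E m))).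
  assert (HD : Definable1 P).
  { refine (definable_ext _ _ (definable_subst (relativized p)
      (fun m => if Nat.eqb m n then inl 0 else inr (val (e m)))
      (fun m => inr (cval (E m))) (relativized_definable p)) _).
    intros e' E'; enough (A :
      (fun m => lookup e' (if Nat.eqb m n then inl 0 else inr (val (e m))))
      = update (fun m => val (e m)) n (e' 0)) by (unfold P; now rewrite <- A).
    extensionality m.
    unfold update; now destruct (Nat.eqb m n). }
  destruct (class_of (fun x => nob K x /\ P x)) as [X HX].
  assert (HXs : forall u, cmem M (val u) X <-> sat N (update e n u) E p).
  { intro u; rewrite HX, sat_relativized, (update_comp val e n u).
    split; [tauto|]; split; [apply val_nob|assumption]. }
  assert (HN : ncls K X).
  { split; [intros u Hu; now apply HX in Hu|].
    destruct (common_support (obj_bound p) (cls_bound p) e E) as (s & Hs & He & HE).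
    exists s; split; [assumption|].
    intros a b Ha Hb Hab Has Hbs u Hu.
    assert (Hun : nob K u) by now apply HX in Hu.
    apply (HXs (mk u Hun)) in Hu; apply (HXs (pi_obj Ha Hb Hab (mk u Hun))).
    apply (sat_pi Ha Hb Hab) in Hu; revert Hu; apply sat_agree.
    - intros m Hm.
      destruct (Nat.eq_dec m n) as [->|Hmn]; [now rewrite !update_same|].
      rewrite !update_other by assumption; apply val_inj.
      symmetry; apply (pi_fix Ha Hb); intro A; [apply Has|apply Hbs]; eauto.
    - intros m Hm; symmetry; apply (pi_cls_fix Ha Hb Hab s); auto. }
  exists (cmk X HN); exact HXs.
Qed.

Lemma N_KMU_R : KMU_R N.
Proof.
  repeat split.
  - exact N_urelements_empty.
  - exact N_extensionality.
  - exact N_foundation.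
  - exact N_pairing.
  - exact N_union.
  - exact N_powerset.
  - exact N_infinity.
  - exact N_separation.
  - exact N_class_extensionality.
  - exact N_replacement.
  - exact N_comprehension.
Qed.

(** ** Choice, ordinals and cardinals *)

Lemma N_image s (R : V -> V -> Prop) {HR : Definable2 R} r :
  (forall x y y', x ∈ s -> R x y -> R x y' -> y = y') ->
  (forall x y, x ∈ s -> R x y -> nob K y /\ cov K r y) ->
  exists y : obj N, is_set N y /\ forall v, nm v (val y) <-> exists x, x ∈ s /\ R x v.
Proof.
  intros Hf Hc.
  assert (HI : forall y, y ∈ img R s <-> exists x, x ∈ s /\ R x y)
    by (intro; now apply img_spec).
  assert (HN : nob K (ns (img R s))).
  { apply (ns_nob _ r); intros v Hv; apply HI in Hv as (x & Hx & Hv); eapply Hc; eauto. }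
  exists (mk _ HN); split; [apply N_is_set, ns_set|]; intro v; simpl.
  rewrite ns_nm, HI; split; [tauto|]; intros (x & Hx & Hv); split; [|eauto].
  now apply (Hc x v Hx Hv).
Qed.

Lemma N_AC : AC N.
Proof.
  intros x Hx.
  destruct (HAC (val x) (no_ur _)) as (W & _ & HW1 & HW2 & HW3 & HW4).
  destruct (val_nob x) as [_ [r Hr]].
  pose (R q p := exists a b, q = op a b /\ nm a (val x) /\ nm b (val x) /\
    op a b ∈ W /\ p = nop a b).
  assert (HR : Definable2 R) by (unfold R; definability).
  destruct (N_image (prod (val x) (val x)) R r) as (r' & Hr' & HI).
  - intros q y y' _ (a & b & -> & _ & _ & _ & ->) (a' & b' & E & _ & _ & _ & ->).
    now apply op_inj in E as [-> ->].
  - intros q y _ (a & b & _ & Ha & Hb & _ & ->); split.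
    + apply nop_nob; eapply nob_nm; eauto using val_nob.
    + apply cov_nop; apply cov_mono with (val x); eauto using rt_step.
  - assert (HS : forall a b, mem N a x -> mem N b x ->
      (srel N r' a b <-> srel M W (val a) (val b))).
    { intros a b Ha Hb; rewrite N_srel, HI, srel_op; split.
      - intros (q & _ & a' & b' & _ & Ha' & Hb' & H & E).
        apply nop_inj in E as [-> ->]; auto using val_neq; [apply Ha'|apply Hb'].
      - intro H; exists (op (val a) (val b)); split.
        + apply prod_op; split; [apply Ha|apply Hb].
        + exists (val a), (val b); auto. }
    exists r'; split; [assumption|]; repeat split.
    + intros a Ha H; apply HS in H; auto; apply (HW1 (val a)); [apply Ha|assumption].
    + intros a b c Ha Hb Hc Hab Hbc; apply HS in Hab, Hbc; auto; apply HS; auto.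
      apply (HW2 (val a) (val b) (val c)); auto; [apply Ha|apply Hb|apply Hc].
    + intros a b Ha Hb; rewrite !HS by assumption.
      destruct (HW3 (val a) (val b)) as [H|[H|H]]; auto; [apply Ha|apply Hb|].
      right; left; now apply val_inj.
    + intros y Hy Hyx [a Ha].
      assert (HP : forall v, v ∈ sep (fun v => nm v (val y)) (val x) <-> nm v (val y)).
      { intro v; rewrite (sep_spec _); split; [tauto|]; intro Hv; split; [|assumption].
        destruct (nm_lift v y Hv) as [w <-]; now apply Hyx. }
      destruct (HW4 (sep (fun v => nm v (val y)) (val x))) as (m & Hm & Hmin).
      * apply no_ur.
      * intros v Hv; rewrite (sep_spec _) in Hv; tauto.
      * exists (val a); now apply HP.
      * apply HP in Hm; destruct (nm_lift m y Hm) as [m' <-]; exists m'.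
        split; [assumption|]; intros b Hb.
        destruct (Hmin (val b)) as [E|H]; [now apply HP|left; now apply val_inj|right].
        apply HS; auto.
Qed.

Lemma jN_ordinal a : is_ordinal M a -> is_ordinal N (jN a).
Proof.
  intros (_ & Htr & H1 & H2 & H3 & H4); split; [apply jN_is_set|]; split.
  - intros x Hx; apply jN_mem_inv in Hx as (b & Hb & ->); split; [apply jN_is_set|].
    intros z Hz; apply jN_mem_inv in Hz as (c & Hc & ->); apply jN_mem.
    now apply (proj2 (Htr b Hb)).
  - split; [|split; [|split]].
    + intros x Hx; apply jN_mem_inv in Hx as (b & Hb & ->); rewrite jN_mem; auto.
    + intros x y z Hx Hy Hz; apply jN_mem_inv in Hx as (b & Hb & ->).
      apply jN_mem_inv in Hy as (c & Hc & ->); apply jN_mem_inv in Hz as (d & Hd & ->).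
      rewrite !jN_mem; eauto.
    + intros x y Hx Hy; apply jN_mem_inv in Hx as (b & Hb & ->).
      apply jN_mem_inv in Hy as (c & Hc & ->); rewrite !jN_mem.
      destruct (H3 b c Hb Hc) as [H|[->|H]]; auto.
    + intros y Hy Hya [x Hx].
      assert (HP : forall v, v ∈ sep (fun v => nm (j v) (val y)) a <->
        v ∈ a /\ mem N (jN v) y) by (intro; now rewrite (sep_spec _)).
      destruct (H4 (sep (fun v => nm (j v) (val y)) a)) as (m & Hm & Hmin).
      * apply no_ur.
      * intros v Hv; now apply HP in Hv.
      * pose proof (Hya x Hx) as H; apply jN_mem_inv in H as (b & Hb & ->).
        exists b; now apply HP.
      * apply HP in Hm as [Hm Hmy]; exists (jN m); split; [assumption|]; intros z Hz.
        pose proof (Hya z Hz) as H; apply jN_mem_inv in H as (b & Hb & ->).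
        rewrite jN_mem; destruct (Hmin b) as [->|H]; auto; now apply HP.
Qed.

Lemma jN_limit l : is_limit M l -> is_limit N (jN l).
Proof.
  intros (Ho & [x Hx] & H); split; [now apply jN_ordinal|]; split.
  - exists (jN x); now apply jN_mem.
  - intros y Hy; apply jN_mem_inv in Hy as (b & Hb & ->).
    destruct (H b Hb) as (c & Hc & Hbc); exists (jN c); now rewrite !jN_mem.
Qed.

Lemma N_fun_dom f d x y : is_fun N f d -> srel N f x y -> mem N x d.
Proof.
  intros (_ & H & _) (p & Hp & Hpf); destruct (H p Hpf) as (x' & y' & Hx' & Hp').
  apply N_pair in Hp, Hp'; rewrite Hp in Hp'; now apply val_nop_inj in Hp' as [-> _].
Qed.

Lemma jN_bijection_reflect f a k : is_bijection N f (jN a) (jN k) ->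
  exists g, is_bijection M g a k.
Proof.
  intros (Hfun & Hran & Hinj & Hsur); pose proof (proj2 (proj2 Hfun)) as Hf.
  exists (sep (fun p => exists x y, p = op x y /\ nm (nop (j x) (j y)) (val f)) (prod a k)).
  assert (HS : forall x y, srel M (sep (fun p => exists x y, p = op x y /\
    nm (nop (j x) (j y)) (val f)) (prod a k)) x y <->
    x ∈ a /\ y ∈ k /\ srel N f (jN x) (jN y)).
  { intros x y; rewrite srel_op, (sep_spec _), prod_op, N_srel; split.
    - intros [[Hx Hy] (x' & y' & E & H)]; apply op_inj in E as [-> ->]; auto.
    - intros (Hx & Hy & H); eauto 6. }
  repeat split.
  - apply no_ur.
  - intros p Hp; rewrite (sep_spec _), prod_spec in Hp.
    destruct Hp as [(x & y & Hx & _ & ->) _]; exists x, y; now rewrite is_pair_op.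
  - intros x Hx; destruct (Hf (jN x)) as (y' & Hy' & Hu); [now apply jN_mem|].
    pose proof (Hran _ _ Hy') as H; apply jN_mem_inv in H as (y & Hy & ->).
    exists y; split; [now apply HS|]; intros z Hz; apply HS in Hz as (_ & _ & Hz).
    now apply jN_inj, Hu.
  - intros x y H; now apply HS in H.
  - intros x x' y H H'; apply HS in H as (_ & _ & H), H' as (_ & _ & H').
    apply jN_inj; eauto.
  - intros y Hy; destruct (Hsur (jN y)) as [x' Hx']; [now apply jN_mem|].
    pose proof (N_fun_dom _ _ _ _ Hfun Hx') as A.
    apply jN_mem_inv in A as (x & Hx & ->); exists x; now apply HS.
Qed.

Lemma jN_infinite_cardinal k : is_infinite_cardinal M k -> is_infinite_cardinal N (jN k).
Proof.
  intros ((Ho & Hk) & l & Hl & Hlk); split; [split; [now apply jN_ordinal|]|].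
  - intros a Ha [f Hf]; apply jN_mem_inv in Ha as (b & Hb & ->).
    exact (Hk b Hb (jN_bijection_reflect f b k Hf)).
  - exists (jN l); split; [now apply jN_limit|]; destruct Hlk as [->|H]; [auto|right].
    now apply jN_mem.
Qed.

Lemma jN_same_ordinal k : same_ordinal M N k (jN k).
Proof.
  exists jN; split; [|split].
  - intros a Ha; now apply jN_mem.
  - intros b Hb; apply jN_mem_inv in Hb as (a & Ha & ->); eauto.
  - intros a b _ _; symmetry; apply jN_mem.
Qed.

(** ** Failure of Collection *)

(* Cantor's diagonal argument: a set of urelements meeting all columns cannot be
   covered by a family indexed by [K]. *)
Lemma N_not_Collection : ~ Collection N.
Proof.
  intro HC.
  pose (P a s := subset M s K /\ atom a /\ forall c, c ∈ K -> (c ∈ a <-> c ∈ s)).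
  assert (HP : Definable2 P) by (unfold P; definability).
  destruct (class_of (fun p => exists s a, P a s /\ p = nop (j s) a)) as [X HX].
  assert (HXn : ncls K X).
  { split.
    - intros u Hu; apply HX in Hu as (s & a & (_ & Ha & _) & ->).
      apply nop_nob; [apply nob_j|now apply (nob_atom HQK)].
    - exists (j emp); split; [apply nob_j|].
      intros a b Ha Hb Hab _ _ u Hu; apply HX in Hu as (s & c & (Hs & Hc & Hcs) & ->).
      apply HX; exists s, (pi a b c); split.
      + split; [assumption|]; split; [now apply pi_atom|]; intros x Hx.
        now rewrite (same_pi a b c Ha Hb Hab Hc x Hx), (Hcs x Hx).
      + rewrite pi_nop; auto; [now rewrite pi_j|apply emp_neq_of_mem, j_set|apply Hc]. }
  destruct (HC (cmk X HXn) (jN (pw K))) as (v & Hv & H).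
  - apply jN_is_set.
  - intros x Hx; apply jN_mem_inv in Hx as (s & Hs & ->); apply pw_spec in Hs.
    destruct (fresh_atom HQK s emp Hs) as (a & Ha & Has & _).
    exists (mk a (nob_atom HQK a Ha)); apply N_crel, HX; exists s, a.
    split; [now split|reflexivity].
  - destruct (val_nob v) as [_ [r Hr]].
    set (D := sep (fun k => op k k ∉ r) K).
    destruct (H (jN D)) as (y & Hy & Hay).
    + apply jN_mem, pw_spec; intros c Hc; unfold D in Hc.
      rewrite (sep_spec _) in Hc; tauto.
    + apply N_crel, HX in Hay as (s & a & (Hs & Ha & Has) & E).
      apply nop_inj in E as [E1 E2];
        [|apply val_neq|apply val_neq|apply emp_neq_of_mem, j_set|apply Ha].
      apply j_inj in E1 as <-; subst a.
      destruct (Hr (val y) Ha) as (k & Hk & Hkc).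
      { apply rt_step with (val y); [exact Hy|apply rt_refl]. }
      specialize (Hkc k Hk); specialize (Has k Hk); unfold D in Has.
      rewrite (sep_spec _) in Has; tauto.
Qed.

(** ** Dependent choice *)

Definition graph_code (h : V) : V :=
  img (fun q p => exists v z, q = op v z /\ p = nop (j v) z) h.

Lemma graph_code_spec h p :
  p ∈ graph_code h <-> exists v z, op v z ∈ h /\ p = nop (j v) z.
Proof.
  unfold graph_code; rewrite img_spec.
  - split; [intros (q & Hq & v & z & -> & ->); eauto|intros (v & z & H & ->); eauto 6].
  - typeclasses eauto.
  - intros q y y' _ (v & z & -> & ->) (v' & z' & E & ->).
    now apply op_inj in E as [-> ->].
Qed.

Instance graph_code_definable : DefinableFun1 graph_code.
Proof.
  apply (definable_fun1_of_mem _ (fun p h => exists v z, op v z ∈ h /\ p = nop (j v) z)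
    graph_code_spec); definability.
Qed.

Definition nf (h : V) : V := ns (graph_code h).

Instance nf_definable : DefinableFun1 nf.
Proof. unfold nf; definability. Qed.

Lemma nf_nm h p : nm p (nf h) <-> exists v z, op v z ∈ h /\ p = nop (j v) z.
Proof.
  unfold nf; rewrite ns_nm, graph_code_spec; split; [tauto|].
  intros (v & z & H & ->); split; [apply ns_neq|eauto].
Qed.

Lemma nf_nob h x : fun_on h x -> (forall v, v ∈ x -> v ∈ Q) ->
  (forall v z, op v z ∈ h -> nob K z) -> nob K (nf h).
Proof.
  intros Hh Hx Hn.
  destruct (cov_family HQK HAC (fun q z => op q z ∈ h)) as [r Hr].
  - intros q u u'; now apply fun_on_functional with x.
  - apply (ns_nob _ r); intros p Hp; apply graph_code_spec in Hp as (v & z & H & ->).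
    apply cov_nop.
    + intros a Ha A; now apply j_pure in A.
    + apply (Hr v z); [|assumption|now apply Hn with v].
      now apply Hx, (fun_on_dom h x v z).
Qed.

Section DependentChoice.
Context (k : V) (Hk : is_ordinal M k) (HkQ : forall q, q ∈ k -> q ∈ Q).
Context (R : cls N) (HR : forall x, exists y, crel N R x y).

Definition choice_rel (h y : V) : Prop := nob K y /\ cmem M (nop (nf h) y) (cval R).

Instance choice_rel_definable : Definable2 choice_rel.
Proof. unfold choice_rel; definability. Qed.

Definition next (h : V) : V := scott (fun y => choice_rel h y).

Lemma next_spec h y :
  y ∈ next h <-> choice_rel h y /\ forall y', choice_rel h y' -> rle y y'.
Proof. unfold next; now rewrite (scott_spec _). Qed.

Instance next_definable : DefinableFun1 next.
Proof.
  apply (definable_fun1_of_mem _ (fun y h => choice_rel h y /\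
    forall y', choice_rel h y' -> rle y y') next_spec); definability.
Qed.

(* [stage a] collects the minimal-rank candidates for the value at [a] over all
   functions on [a] whose values were candidates at the earlier stages. *)
Definition stage_step (_ a g : V) : V :=
  un (img (fun h s => s = next h)
    (sep (fun h => fun_on h a /\
        forall b y, op b y ∈ h -> exists z, op b z ∈ g /\ y ∈ z)
      (pw (prod a (un (ran g)))))).

Lemma stage_step_spec p a g w : w ∈ stage_step p a g <->
  exists h, fun_on h a /\ (forall b y, op b y ∈ h -> exists z, op b z ∈ g /\ y ∈ z) /\
    w ∈ next h.
Proof.
  unfold stage_step; rewrite un_spec; split.
  - intros (s & Hs & Hw); rewrite (fimg_spec next) in Hs.
    destruct Hs as (h & Hh & ->); rewrite (sep_spec _) in Hh; exists h; tauto.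
  - intros (h & Hh & Hg & Hw); exists (next h); split; [|assumption].
    rewrite (fimg_spec next); exists h; split; [|reflexivity].
    rewrite (sep_spec _); split; [|now split]; apply pw_spec; intros p' Hp'.
    destruct (proj1 Hh p' Hp') as (b & y & Hb & ->); apply prod_op; split; [assumption|].
    destruct (Hg b y Hp') as (z & Hz & Hy); apply un_spec; exists z.
    split; [apply ran_spec; eauto|assumption].
Qed.

Instance stage_step_definable : DefinableFun3 stage_step.
Proof.
  apply (definable_fun3_of_mem _ (fun w p a g => exists h, fun_on h a /\
    (forall b y, op b y ∈ h -> exists z, op b z ∈ g /\ y ∈ z) /\ w ∈ next h)
    stage_step_spec); definability.
Qed.

Definition stage (a : V) : V := rec stage_step emp a.

Instance stage_definable : DefinableFun1 stage.
Proof. pose proof (rec_definable stage_step) as H; unfold stage; definability. Qed.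

Lemma stage_spec a w : w ∈ stage a <->
  exists h, fun_on h a /\ (forall b y, op b y ∈ h -> y ∈ stage b) /\ w ∈ next h.
Proof.
  unfold stage at 1; destruct (rec_unfold stage_step emp a) as (g & _ & Hg & ->).
  rewrite stage_step_spec; split; intros (h & Hh & H & Hw); exists h;
    (split; [assumption|]; split; [|assumption]); intros b y Hy.
  - destruct (H b y Hy) as (z & Hz & Hyz); apply Hg in Hz as [_ ->]; exact Hyz.
  - exists (stage b); split; [|auto]; apply Hg; split; [|reflexivity].
    now apply (fun_on_dom h a b y).
Qed.

Lemma N_DC_for : exists f, is_fun N f (jN k) /\ forall a, mem N a (jN k) ->
  exists g y, is_restriction N g f a /\ srel N f a y /\ crel N R g y.
Proof.
  set (ZZ := un (img (fun a z => z = stage a) k)).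
  assert (HZZ : forall a y, a ∈ k -> y ∈ stage a -> y ∈ ZZ).
  { intros a y Ha Hy; apply un_spec; exists (stage a); split; [|assumption].
    rewrite (fimg_spec stage); eauto. }
  destruct (HAC ZZ (no_ur _)) as (W & _ & HW1 & HW2 & HW3 & HW4).
  pose (pick (_ _ g : V) :=
    un (sep (fun y => forall y', y' ∈ next g -> y = y' \/ op y y' ∈ W) (next g))).
  assert (Hpick : DefinableFun3 pick).
  { apply (definable_fun3_of_mem _ (fun w _ _ g => exists y, (y ∈ next g /\
      forall y', y' ∈ next g -> y = y' \/ op y y' ∈ W) /\ w ∈ y)); [|definability].
    intros p x g w; unfold pick; rewrite un_spec.
    split; intros (y & Hy & Hw); exists y;
      (split; [|assumption]); [rewrite (sep_spec _) in Hy|rewrite (sep_spec _)]; tauto. }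
  pose (F a := rec pick emp a).
  assert (HF : DefinableFun1 F).
  { pose proof (rec_definable pick) as H; unfold F; definability. }
  assert (main : forall a, a ∈ k -> F a ∈ stage a /\ nob K (F a) /\
    forall g, fun_on g a -> (forall b y, op b y ∈ g <-> b ∈ a /\ y = F b) ->
      nob K (nf g) /\ cmem M (nop (nf g) (F a)) (cval R)).
  { apply (mem_induction (fun a => a ∈ k -> F a ∈ stage a /\ nob K (F a) /\
      forall g, fun_on g a -> (forall b y, op b y ∈ g <-> b ∈ a /\ y = F b) ->
      nob K (nf g) /\ cmem M (nop (nf g) (F a)) (cval R))).
    intros a IH Ha.
    assert (Hak : forall b, b ∈ a -> b ∈ k) by (apply (proj1 (proj2 Hk)); assumption).
    unfold F at 1 2; destruct (rec_unfold pick emp a) as (g & Hg & Hgs & E).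
    rewrite E; clear E.
    assert (Hgn : nob K (nf g)).
    { apply nf_nob with a; auto; intros v z Hvz; apply Hgs in Hvz as [Hv ->].
      apply IH; auto. }
    assert (Hsub : forall y, y ∈ next g -> y ∈ stage a).
    { intros y Hy; apply stage_spec; exists g; split; [assumption|]; split; [|assumption].
      intros b z Hz; apply Hgs in Hz as [Hb ->]; apply IH; auto. }
    destruct (HR (mk _ Hgn)) as [y0 Hy0]; apply N_crel in Hy0.
    destruct (rle_minimal (fun y => choice_rel g y)) as (y1 & Hy1 & Hmin).
    { exists (val y0); split; [apply val_nob|exact Hy0]. }
    destruct (HW4 (next g)) as (y & Hy & Hleast).
    { apply no_ur. }
    { intros z Hz; apply (HZZ a); auto. }
    { exists y1; now apply next_spec. }
    assert (Epick : pick emp a g = y).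
    { assert (A : forall z, z ∈ sep (fun y => forall y', y' ∈ next g -> y = y' \/
        op y y' ∈ W) (next g) <-> z = y).
      { intro z; rewrite (sep_spec _); split.
        - intros [Hz Hz']; destruct (Hz' y Hy) as [|A]; [assumption|].
          destruct (Hleast z Hz) as [|B]; [now symmetry|]; apply srel_op in A.
          destruct (HW1 z); [apply (HZZ a); auto|].
          apply (HW2 z y z); auto; apply (HZZ a); auto.
        - intros ->; split; [assumption|]; intros y' Hy'; rewrite <- srel_op; auto. }
      unfold pick; apply set_ext; intro w; rewrite un_spec; split.
      - intros (z & Hz & Hw); now apply A in Hz as ->.
      - intro Hw; exists y; split; [now apply A|assumption]. }
    assert (EF : F a = y).
    { unfold F; destruct (rec_unfold pick emp a) as (g' & Hg' & Hgs' & ->).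
      rewrite <- Epick; unfold pick; replace g' with g; [reflexivity|].
      apply set_ext; intro q; split; intro Hq.
      - destruct (proj1 Hg q Hq) as (v & z & Hv & ->); apply Hgs', Hgs; assumption.
      - destruct (proj1 Hg' q Hq) as (v & z & Hv & ->); apply Hgs, Hgs'; assumption. }
    rewrite Epick; apply next_spec in Hy as Hy'; destruct Hy' as [[Hyn Hyc] _].
    split; [auto|]; split; [assumption|].
    intros g' Hg' Hgs'; replace g' with g; [rewrite EF; auto|].
    apply set_ext; intro q; split; intro Hq.
    - destruct (proj1 Hg q Hq) as (v & z & Hv & ->); apply Hgs'; now apply Hgs in Hq.
    - destruct (proj1 Hg' q Hq) as (v & z & Hv & ->); apply Hgs; now apply Hgs' in Hq. }
  pose (res a := img (fun b p => p = op b (F b)) a).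
  assert (Hres : forall a b y, op b y ∈ res a <-> b ∈ a /\ y = F b).
  { intros a b y; unfold res; rewrite (fimg_spec (fun b => op b (F b))); split.
    - intros (v & Hv & E); now apply op_inj in E as [-> ->].
    - intros [Hb ->]; eauto. }
  assert (Hfun : forall a, fun_on (res a) a).
  { intro a; split.
    - intros p Hp; unfold res in Hp; rewrite (fimg_spec (fun b => op b (F b))) in Hp.
      destruct Hp as (v & Hv & ->); eauto.
    - intros v Hv; exists (F v); split; [now apply Hres|].
      intros y Hy; now apply Hres in Hy. }
  assert (Hnf : forall a p, nm p (nf (res a)) <-> exists v, v ∈ a /\ p = nop (j v) (F v)).
  { intros a p; rewrite nf_nm; split.
    - intros (v & z & Hv & ->); apply Hres in Hv as [Hv ->]; eauto.
    - intros (v & Hv & ->); exists v, (F v); rewrite Hres; auto. }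
  assert (Hk' : nob K (nf (res k))).
  { apply nf_nob with k; auto; intros v z Hv; apply Hres in Hv as [Hv ->].
    now apply main. }
  assert (Hsr : forall v y, v ∈ k -> val y = F v -> srel N (mk _ Hk') (jN v) y).
  { intros v y Hv Hy; apply N_srel, Hnf; exists v; rewrite Hy; auto. }
  exists (mk _ Hk'); split; [split; [apply N_is_set, ns_set|split]|].
  - intros p Hp; apply Hnf in Hp as (v & Hv & E).
    exists (jN v), (mk _ (proj1 (proj2 (main v Hv)))); split; [now apply jN_mem|].
    now apply N_pair.
  - intros x Hx; apply jN_mem_inv in Hx as (v & Hv & ->).
    exists (mk _ (proj1 (proj2 (main v Hv)))); split; [now apply Hsr|].
    intros y Hy; apply N_srel, Hnf in Hy as (v' & Hv' & E).
    apply val_inj; simpl; apply nop_inj in E as [E1 E2];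
      [|apply val_neq|apply val_neq|apply emp_neq_of_mem, j_set|apply (main v' Hv')].
    apply j_inj in E1; congruence.
  - intros x Hx; apply jN_mem_inv in Hx as (a & Ha & ->).
    destruct (main a Ha) as (_ & HFa & Hch).
    destruct (Hch (res a) (Hfun a) (Hres a)) as [Hga Hc].
    exists (mk _ Hga), (mk _ HFa); split; [|split; [now apply Hsr|now apply N_crel]].
    split; [apply N_is_set, ns_set|]; intro p; rewrite !N_mem; simpl.
    rewrite !Hnf; split.
    + intros (v & Hv & E).
      assert (Hvk : v ∈ k) by (apply (proj1 (proj2 Hk) a Ha); assumption).
      split; [eauto|]; exists (jN v), (mk _ (proj1 (proj2 (main v Hvk)))).
      split; [now apply jN_mem|now apply N_pair].
    + intros [(v & Hv & E) (x & y & Hx & Hp)].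
      apply jN_mem_inv in Hx as (c & Hca & ->); apply N_pair in Hp.
      exists v; split; [|assumption]; rewrite E in Hp.
      apply nop_inj in Hp as [E1 _];
        [|apply emp_neq_of_mem, j_set|apply (main v Hv)|apply val_neq|apply val_neq].
      now apply j_inj in E1 as ->.
Qed.

End DependentChoice.

Lemma N_DC k : is_ordinal M k -> (forall q, q ∈ k -> q ∈ Q) -> DC N (jN k).
Proof. intros Hk HkQ R HR; exact (N_DC_for k Hk HkQ R HR). Qed.

End Model.

Lemma urelement_model_exists (M : structure) (kappa : obj M) :
  KM M -> AC M -> is_infinite_cardinal M kappa ->
  exists (N : structure) (kappa' : obj N),
    KMU_R N /\ AC N /\
    is_infinite_cardinal N kappa' /\ same_ordinal M N kappa kappa' /\
    DC N kappa' /\ ~ Collection N.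
Proof.
  intros HM HAC Hk.
  destruct (index_set_exists kappa) as (Q & K & HQ & HQK).
  exists (urelement_model (K := K)), (jN kappa); split; [|split; [|split; [|split; [|split]]]].
  - exact (N_KMU_R HAC HQK).
  - exact (N_AC HAC HQK).
  - exact (jN_infinite_cardinal HAC HQK kappa Hk).
  - exact (jN_same_ordinal kappa).
  - exact (N_DC HAC HQK kappa (proj1 (proj1 Hk)) HQ).
  - exact (N_not_Collection HAC HQK).
Qed.

(** * A model of KM with choice *)

Lemma well_order_exists (T : Type) : exists le : T -> T -> bool,
  forall P : T -> Prop, (exists x, P x) ->
    exists! z, P z /\ forall x, P x -> le z x = true.
Proof.
  destruct (wochoice.well_ordering_principle
    (boolp.boolp_classicType__canonical__eqtype_Equality T)) as [R HR].
  exists R; intros P [x Hx].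
  pose (A := fun x : T => if excluded_middle_informative (P x) then true else false).
  assert (HA : forall x, A x = true <-> P x).
  { intro z; unfold A; destruct (excluded_middle_informative (P z)); intuition discriminate. }
  destruct (HR A) as (z & [Hz Hmin] & Hu).
  - exists x; now apply HA.
  - exists z; split.
    + split; [now apply HA|]; intros y Hy; now apply Hmin, HA.
    + intros y [Hy Hy']; apply Hu; split; [now apply HA|]; intros w Hw; now apply Hy', HA.
Qed.

Lemma strict_well_order_exists (T : Type) : exists lt : T -> T -> Prop,
  (forall a, ~ lt a a) /\ (forall a b c, lt a b -> lt b c -> lt a c) /\
  (forall a b, lt a b \/ a = b \/ lt b a) /\
  (forall P : T -> Prop, (exists a, P a) ->
    exists a, P a /\ forall b, P b -> a = b \/ lt a b).
Proof.
  destruct (well_order_exists T) as [le Hle].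
  assert (tot : forall a b, le a b = true \/ le b a = true).
  { intros a b; destruct (Hle (fun x => x = a \/ x = b)) as (z & [[-> | ->] H] & _);
      eauto. }
  assert (refl : forall a, le a a = true) by (intro a; destruct (tot a a); assumption).
  assert (anti : forall a b, le a b = true -> le b a = true -> a = b).
  { intros a b Hab Hba.
    destruct (Hle (fun x => x = a \/ x = b)) as (z & _ & Hu); [eauto|].
    rewrite <- (Hu a), <- (Hu b); [reflexivity| |];
      (split; [auto|intros x [-> | ->]; auto]). }
  exists (fun a b => le a b = true /\ a <> b); repeat split.
  - intros a [_ H]; auto.
  - destruct H as [Hab _], H0 as [Hbc _].
    destruct (Hle (fun x => x = a \/ x = b \/ x = c))
      as (z & [[-> | [-> | ->]] H] & _); [eauto|auto| |].
    + now rewrite (anti a b Hab (H a (or_introl eq_refl))).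
    + rewrite <- (anti b c Hbc (H b (or_intror (or_introl eq_refl)))); assumption.
  - destruct H as [Hab H], H0 as [Hbc _]; intros ->; auto.
  - intros a b; destruct (classic (a = b)); [auto|destruct (tot a b); auto].
  - intros P HP; destruct (Hle P HP) as (z & [Hz H] & _); exists z; split; [assumption|].
    intros b Hb; destruct (classic (z = b)); auto.
Qed.

Inductive tree : Type := node (A : Type) (f : A -> tree).

Fixpoint teq (x y : tree) : Prop :=
  match x, y with
  | node A f, node B g =>
      (forall a, exists b, teq (f a) (g b)) /\ (forall b, exists a, teq (f a) (g b))
  end.

Lemma teq_refl x : teq x x.
Proof. induction x as [A f IH]; split; eauto. Qed.

Lemma teq_sym x : forall y, teq x y -> teq y x.
Proof.
  induction x as [A f IH]; intros [B g] [H1 H2]; split.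
  - intro b; destruct (H2 b) as [a Ha]; eauto.
  - intro a; destruct (H1 a) as [b Hb]; eauto.
Qed.

Lemma teq_trans x : forall y z, teq x y -> teq y z -> teq x z.
Proof.
  induction x as [A f IH]; intros [B g] [C h] [H1 H2] [H3 H4]; split.
  - intro a; destruct (H1 a) as [b Hb], (H3 b) as [c Hc]; eauto.
  - intro c; destruct (H4 c) as [b Hb], (H2 b) as [a Ha]; eauto.
Qed.

Definition hset : Type := {C : tree -> Prop | exists x, C = teq x}.
Definition of_tree (x : tree) : hset := exist _ (teq x) (ex_intro _ x eq_refl).

Lemma of_tree_eq x y : of_tree x = of_tree y <-> teq x y.
Proof.
  split.
  - intro H; change (proj1_sig (of_tree x) y); rewrite H; apply teq_refl.
  - intro H; apply eq_sig_hprop; [intros; apply proof_irrelevance|]; simpl.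
    extensionality z; apply propositional_extensionality; split; intro A.
    + apply teq_trans with x; [now apply teq_sym|assumption].
    + now apply teq_trans with y.
Qed.

Lemma of_tree_surj (v : hset) : {x | of_tree x = v}.
Proof.
  apply constructive_indefinite_description; destruct v as [C [x ->]]; now exists x.
Qed.

Definition to_tree (v : hset) : tree := proj1_sig (of_tree_surj v).

Lemma to_tree_of v : of_tree (to_tree v) = v.
Proof. exact (proj2_sig (of_tree_surj v)). Qed.

Definition index (v : hset) : Type := let (A, _) := to_tree v in A.
Definition elt (v : hset) : index v -> hset :=
  match to_tree v as t return (let (A, _) := t in A) -> hset with
  | node A f => fun a => of_tree (f a)
  end.
Definition hmem (u v : hset) : Prop := exists a, u = elt v a.
Definition family {A : Type} (f : A -> hset) : hset :=
  of_tree (node A (fun a => to_tree (f a))).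

Lemma family_spec {A : Type} (f : A -> hset) u :
  hmem u (family f) <-> exists a, u = f a.
Proof.
  pose proof (to_tree_of (family f)) as E; unfold hmem, elt, index.
  unfold family in E at 2; destruct (to_tree (family f)) as [B g].
  apply of_tree_eq in E as [H1 H2]; split.
  - intros [b ->]; destruct (H1 b) as [a Ha]; exists a.
    rewrite <- (to_tree_of (f a)); now apply of_tree_eq.
  - intros [a ->]; destruct (H2 a) as [b Hb]; exists b.
    rewrite <- (to_tree_of (f a)); symmetry; now apply of_tree_eq.
Qed.

Lemma hset_ext x y : (forall z, hmem z x <-> hmem z y) -> x = y.
Proof.
  intro H; rewrite <- (to_tree_of x), <- (to_tree_of y); apply of_tree_eq.
  unfold hmem, elt, index in H; destruct (to_tree x) as [A f], (to_tree y) as [B g].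
  split.
  - intro a; destruct (proj1 (H (of_tree (f a)))) as [b Hb]; [eauto|].
    exists b; now apply of_tree_eq.
  - intro b; destruct (proj2 (H (of_tree (g b)))) as [a Ha]; [eauto|].
    exists a; apply of_tree_eq; now symmetry.
Qed.

Lemma hmem_ind (P : hset -> Prop) :
  (forall x, (forall y, hmem y x -> P y) -> P x) -> forall x, P x.
Proof.
  intros H x; rewrite <- (to_tree_of x); induction (to_tree x) as [A f IH].
  apply H; intros y Hy.
  replace (of_tree (node A f)) with (family (fun a => of_tree (f a))) in Hy.
  - rewrite family_spec in Hy; destruct Hy as [a ->]; apply IH.
  - apply of_tree_eq; split; intro a; exists a; apply of_tree_eq, to_tree_of.
Qed.

Lemma hset_sep (P : hset -> Prop) x :
  exists z, forall w, hmem w z <-> hmem w x /\ P w.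
Proof.
  exists (family (fun a : {a : index x | P (elt x a)} => elt x (proj1_sig a))).
  intro w; rewrite family_spec; split.
  - intros [[a Ha] ->]; split; [now exists a|assumption].
  - intros [[a ->] Ha]; now exists (exist _ a Ha).
Qed.

Definition hset_model : structure := {|
  obj := hset;
  cls := hset -> Prop;
  ur _ := False;
  mem := hmem;
  cmem x X := X x;
  obj_inhabited := inhabits (family (fun a : False => match a with end));
  cls_inhabited := inhabits (fun _ => False)
|}.

Lemma hset_model_KM : KM hset_model.
Proof.
  split; [|intros x H; exact H].
  split; [|split; [|split]];
    [split; [|split; [|split; [|split; [|split; [|split; [|split]]]]]]| | |].
  - intros x y [].
  - intros x y _ _; apply hset_ext.
  - intros x [y Hy]; simpl in *; revert y Hy.
    apply (hmem_ind (fun y => hmem y x ->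
      exists y, hmem y x /\ forall z, hmem z y -> ~ hmem z x)).
    intros y IH Hy; destruct (classic (exists z, hmem z y /\ hmem z x)) as [(z & H1 & H2)|H].
    + now apply (IH z).
    + exists y; split; [assumption|]; intros z H1 H2; eauto.
  - intros x y; exists (family (fun b : bool => if b then x else y)).
    split; [exact (fun H => H)|]; intro w; simpl; rewrite family_spec; split.
    + intros [[|] ->]; auto.
    + intros [-> | ->]; [now exists true|now exists false].
  - intros x _.
    exists (family (fun p : {a : index x & index (elt x a)} =>
      elt (elt x (projT1 p)) (projT2 p))).
    split; [exact (fun H => H)|]; intro w; simpl; rewrite family_spec; split.
    + intros [[a b] ->]; exists (elt x a); split; [now exists a|now exists b].
    + intros (y & [a ->] & [b ->]); now exists (existT _ a b).
  - intros x _.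
    exists (family (fun P : index x -> Prop =>
      family (fun a : {a | P a} => elt x (proj1_sig a)))).
    split; [exact (fun H => H)|]; intro w; simpl; rewrite family_spec; split.
    + intros [P ->]; split; [exact (fun H => H)|]; intros z Hz.
      rewrite family_spec in Hz; destruct Hz as [[a Ha] ->]; now exists a.
    + intros [_ H]; exists (fun a => hmem (elt x a) w); apply hset_ext; intro z.
      rewrite family_spec; split.
      * intro Hz; destruct (H z Hz) as [a ->]; now exists (exist _ a Hz).
      * intros [[a Ha] ->]; exact Ha.
  - pose (num := fix num n := match n with
      | 0 => family (fun a : False => match a with end)
      | S n => family (fun o : option (index (num n)) =>
          match o with Some a => elt (num n) a | None => num n end)
      end).
    exists (family num); split; [exact (fun H => H)|]; split.
    + exists (num 0); split; [apply family_spec; now exists 0|].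
      split; [exact (fun H => H)|]; intros w Hw; simpl in Hw.
      rewrite family_spec in Hw; now destruct Hw as [[] _].
    + intros x Hx; rewrite family_spec in Hx; destruct Hx as [n ->]; exists (num (S n)).
      split; [apply family_spec; now exists (S n)|]; intro w; simpl.
      rewrite family_spec; split.
      * intros [[a|] ->]; [left; now exists a|auto].
      * intros [[a ->] | ->]; [now exists (Some a)|now exists None].
  - intros Y x _; destruct (hset_sep Y x) as [z Hz]; exists z.
    split; [exact (fun H => H)|]; intro w; simpl; rewrite Hz; tauto.
  - intros X Y H; extensionality x; apply propositional_extensionality, H.
  - intros F HF w _.
    pose (D := {a : index w | exists y, crel hset_model F (elt w a) y}).
    pose (val := fun a : D => constructive_indefinite_description _ (proj2_sig a)).
    exists (family (fun a : D => proj1_sig (val a))); split; [exact (fun H => H)|].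
    intro y; simpl; rewrite family_spec; split.
    + intros [a ->]; exists (elt w (proj1_sig a)); split; [now exists (proj1_sig a)|].
      apply (proj2_sig (val a)).
    + intros (x & [a ->] & Hy); set (d := exist _ a (ex_intro _ y Hy) : D).
      exists d; exact (HF (elt w a) y _ Hy (proj2_sig (val d))).
  - intros p n e E; now exists (fun x => sat hset_model (update e n x) E p).
Qed.

Lemma hset_model_AC : AC hset_model.
Proof.
  intros x _; pose proof hset_model_KM as HM.
  destruct (strict_well_order_exists hset) as (lt & H1 & H2 & H3 & H4).
  assert (HD : forall P, Definable1 (M := hset_model) P).
  { intro P.
    apply definable_ext with (fun e _ => cmem hset_model (e 0) P); [definability|tauto]. }
  exists (sep (M := hset_model) (fun p => exists a b, p = op a b /\ lt a b) (prod x x)).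
  assert (HS : forall a b, hmem a x -> hmem b x ->
    (srel hset_model (sep (M := hset_model) (fun p => exists a b, p = op a b /\ lt a b)
      (prod x x)) a b <-> lt a b)).
  { intros a b Ha Hb; rewrite srel_op, (sep_spec _ (HP := HD _)), prod_op; split.
    - intros [_ (a' & b' & E & H)]; now apply op_inj in E as [-> ->].
    - intro H; split; [now split|eauto]. }
  split; [exact (fun H => H)|]; split; [|split; [|split]].
  - intros a Ha; rewrite HS by assumption; auto.
  - intros a b c Ha Hb Hc; rewrite !HS by assumption; eauto.
  - intros a b Ha Hb; rewrite !HS by assumption; auto.
  - intros y _ Hy Hne; destruct (H4 (fun a => hmem a y) Hne) as (a & Ha & H).
    exists a; split; [assumption|]; intros b Hb; rewrite HS by (now apply Hy); auto.
Qed.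

Theorem theorem4p12 :
  consistent KM ->
  consistent (fun M => KM M /\ AC M) /\
  forall (M : structure) (kappa : obj M),
    KM M -> AC M -> is_infinite_cardinal M kappa ->
    exists (N : structure) (kappa' : obj N),
      KMU_R N /\ AC N /\
      is_infinite_cardinal N kappa' /\ same_ordinal M N kappa kappa' /\
      DC N kappa' /\ ~ Collection N.
Proof.
  intros _; split.
  - exists hset_model; split; [exact hset_model_KM|exact hset_model_AC].
  - exact urelement_model_exists.
Qed.
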